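(* Let $p$ be a prime and let $G$ be a pro-$p$-group with generator rank $d=\dim_{\mathbb{F}_p}H^1(G,\mathbb{F}_p)<\infty$ and relation rank $r=\dim_{\mathbb{F}_p}H^2(G,\mathbb{F}_p)<\infty$. Fix a minimal presentation and a Zassenhaus-adapted system of defining relations $\rho_1,\dots,\rho_r$ as described in the context, with associated integers $r_k$ ($k\ge 0$), $c_n$ and $e_n$ ($n\in\mathbb{Z}$). Then for every $n\geq 1$, $$\sum_{i=0}^n r_i\,c_{n-i}-d\,c_{n-1}=1+e_n .$$
   Context: For a pro-$p$-group $H$, $\mathbb{F}_p[H]$ denotes the completed group algebra over $\mathbb{F}_p$, and $I(H)$ its augmentation ideal, i.e. the kernel of $\sum a_ih_i\mapsto\sum a_i$. The $n$-th modular dimension subgroup is $H_n=\{h\in H: h-1\in I(H)^n\}$. Let $1\to R\to F\xrightarrow{\phi} G\to 1$ be a minimal presentation: $F$ is a free pro-$p$-group on $d$ generators $\sigma_1,\dots,\sigma_d$ lifting a minimal generating set of $G$, and $R$ is generated as a closed normal subgroup by $r$ elements. For $1\ne\rho\in F$, its level is the largest $n$ with $\rho\in F_n$. The relations are chosen inductively: $S_0=\emptyset$, and $S_n=S_{n-1}\cup\{\rho_{n,1},\dots,\rho_{n,r_n}\}$, where the new elements $\rho_{n,j}$ have level $n$ and, together with $S_{n-1}$, form a minimal system of generators of $RF_{n+1}/F_{n+1}$ (as a normal subgroup of $F/F_{n+1}$). This defines $r_k\ge 0$ for $k\ge1$, the number of relations of level $k$, with $\sum_k r_k=r$; one has $r_1=0$.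 By convention $r_0=1$. Enumerate all chosen relations as $\rho_1,\dots,\rho_r$. The algebra $\mathbb{F}_p[F]$ is identified with the algebra $\mathbb{F}_p\langle\langle x_1,\dots,x_d\rangle\rangle$ of formal power series in non-commuting variables via $\sigma_i\mapsto 1+x_i$; let $f_i$ be the image of $\rho_i-1$ and $v(f_i)$ the level of $\rho_i$ (equivalently, the largest $n$ with $f_i$ in the $n$-th power of the ideal $(x_1,\dots,x_d)$). For $f$ without constant term, the Fox derivatives $\partial f/\partial x_j$ are defined by the unique decomposition $f=\sum_{j=1}^d\frac{\partial f}{\partial x_j}x_j$. Let $\phi:\mathbb{F}_p[F]\to\mathbb{F}_p[G]$ be induced by $F\to G$, $I=I(G)$, and set $I^n=\mathbb{F}_p[G]$ for $n\le 0$. Define $c_n=\dim_{\mathbb{F}_p}\mathbb{F}_p[G]/I^n$ (so $c_n=0$ for $n\le0$). For $n\ge1$, let $$J_n:\bigoplus_{i=1}^r\mathbb{F}_p[G]/I^{\,n-v(f_i)}\to\bigoplus_{j=1}^d\mathbb{F}_p[G]/I^{\,n-1},\qquad (g_1,\dots,g_r)\mapsto\Big(\sum_{i=1}^r g_i\,\phi\big(\tfrac{\partial f_i}{\partial x_j}\big)\Big)_{j=1}^d,$$ and put $e_n=\dim_{\mathbb{F}_p}\ker J_n$ (and $e_n=0$ for $n\le 0$). *)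

(* Defs.v *)
From HB Require Import structures.
From mathcomp Require Import all_boot all_order all_fingroup all_algebra.
From mathcomp Require Import generic_quotient finmap.
From mathcomp Require Import mathcomp_extra boolp classical_sets functions.
From mathcomp Require Import cardinality filter topology.

Set Implicit Arguments.
Unset Strict Implicit.
Unset Printing Implicit Defensive.

Import GRing.Theory.
Local Open Scope classical_set_scope.
Local Open Scope quotient_scope.
Local Open Scope ring_scope.

HB.mixin Record isTopologicalGroup G & monoid.Group G & Topological G := {
  mulg_continuous : continuous (fun xy : G * G => (xy.1 * xy.2)%g) ;
  invg_continuous : continuous (fun x : G => (x^-1)%g)
}.

#[short(type="topologicalGroupType")]
HB.structure Definition TopologicalGroup :=
  { G of monoid.Group G & Topological G & isTopologicalGroup G }.

HB.mixin Record isProfinite G & TopologicalGroup G := {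
  profinite_compact : compact [set: G] ;
  profinite_hausdorff : hausdorff_space G ;
  profinite_disconnected : totally_disconnected [set: G]
}.

#[short(type="profiniteGroupType")]
HB.structure Definition ProfiniteGroup :=
  { G of TopologicalGroup G & isProfinite G }.

HB.structure Definition ContinuousHom (G H : topologicalGroupType) :=
  { f of @UMagmaMorphism G H f & @isContinuous G H f }.

Notation "{ 'chom' G -> H }" := (ContinuousHom.type G%type H%type)
  (at level 0, G at level 98, H at level 99,
   format "{ 'chom'  G  ->  H }") : type_scope.

Section Subgroups.
Variable G : topologicalGroupType.
Implicit Type A : set G.

Definition subgroup A :=
  [/\ A 1%g, (forall x y, A x -> A y -> A (x * y)%g)
    & (forall x, A x -> A (x^-1)%g)].

Definition normal_subgroup A :=
  subgroup A /\ forall x y, A x -> A (x ^ y)%g.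

Definition closed_subgroup A := closed A /\ subgroup A.
Definition closed_normal_subgroup A := closed A /\ normal_subgroup A.

Record openNormal := OpenNormal {
  openNormal_set :> G -> Prop ;
  openNormalP : open openNormal_set /\ normal_subgroup openNormal_set }.

Lemma openNormal_setT_subproof : open [set: G] /\ normal_subgroup [set: G].
Proof. by split; [exact: openT | split=> //; split]. Qed.

Definition openNormalT := OpenNormal openNormal_setT_subproof.

End Subgroups.

Lemma openNormal_preimage_subproof (G H : topologicalGroupType)
    (f : {chom G -> H}) (U : openNormal H) :
  open (f @^-1` U) /\ normal_subgroup (f @^-1` U).
Proof.
have [oU [[U1 UM UV] UJ]] := openNormalP U; split.
  by apply: open_comp => // x _; exact: cts_fun.
have fM x y : f (x * y)%g = (f x * f y)%g by exact: gmulfM.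
have f1 : f 1%g = 1%g by exact: gmulf1.
have fV x : f (x^-1)%g = ((f x)^-1)%g.
  by apply: (@mulgI _ (f x)); rewrite -fM !mulgV f1.
split; first split; rewrite /preimage /= ?f1 //.
- by move=> x y; rewrite fM; exact: UM.
- by move=> x; rewrite fV; exact: UV.
- by move=> x y; rewrite conjgE !fM fV; exact: UJ.
Qed.

Definition openNormal_preimage (G H : topologicalGroupType)
    (f : {chom G -> H}) (U : openNormal H) :=
  OpenNormal (openNormal_preimage_subproof f U).

Section Quotient.
Variables (G : profiniteGroupType) (U : openNormal G).

Definition same_coset (x y : G) : bool := `[< U (x^-1 * y)%g >].

Lemma same_coset_refl : reflexive same_coset.
Proof. by move=> x; apply/asboolP; rewrite mulVg; have [_ [[]]] := openNormalP U. Qed.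

Lemma same_coset_sym : symmetric same_coset.
Proof.
have [_ [[_ _ UV] _]] := openNormalP U.
by move=> x y; apply/asboolP/asboolP => /UV; rewrite invgM invgK.
Qed.

Lemma same_coset_trans : transitive same_coset.
Proof.
have [_ [[_ UM _] _]] := openNormalP U.
move=> y x z /asboolP Uxy /asboolP Uyz; apply/asboolP.
by have := UM _ _ Uxy Uyz; rewrite -mulgA (mulgA y) mulgV mul1g.
Qed.

Canonical same_coset_equiv :=
  EquivRel same_coset same_coset_refl same_coset_sym same_coset_trans.

Definition quo := {eq_quot same_coset_equiv}.
HB.instance Definition _ := Choice.on quo.
HB.instance Definition _ := EqQuotient.on quo.

Definition coset_proj (x : G) : quo := \pi x.
Definition coset_repr (c : quo) : G := repr c.

Lemma coset_reprK : cancel coset_repr coset_proj.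
Proof. exact: reprK. Qed.

Lemma coset_projP (x y : G) :
  (coset_proj x = coset_proj y) <-> U (x^-1 * y)%g.
Proof.
split; first by move=> /eqmodP /asboolP.
by move=> h; apply/eqmodP; apply/asboolP.
Qed.

Lemma coset_reprP (x : G) : U (x^-1 * coset_repr (coset_proj x))%g.
Proof. by apply/coset_projP; rewrite coset_reprK. Qed.

Lemma quo_finite : finite_set [set: quo].
Proof.
have [oU [[U1 _ _] _]] := openNormalP U.
pose B x := [set y | U (x^-1 * y)%g].
have oB x : open (B x).
  apply: (@open_comp _ _ (fun y => (x^-1 * y)%g)) => // y _.
  apply: (@cvg_comp _ _ _ (fun y => (x^-1%g, y)) (fun z => (z.1 * z.2)%g)
    (nbhs y) (nbhs (x^-1%g, y))).
    by apply: (@cvg_pair _ _ _ (nbhs y) (nbhs x^-1%g) (nbhs y));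
      [exact: cvg_cst | exact: cvg_id].
  exact: (mulg_continuous (x^-1%g, y)).
pose T : Type := G.
pose Tp : ptopologicalType :=
  HB.pack T (Topological.class G) (isPointed.Build T (1%g : G)).
have := @profinite_compact G.
rewrite (_ : compact _ = @compact Tp setT) // compact_cover.
move=> /(_ G setT B (fun x _ => oB x)) [].
  by move=> x _; exists x => //=; rewrite /B /= mulVg.
move=> D _ Dcov.
apply/finite_seqP; exists [seq coset_proj x | x <- enum_fset D].
apply/seteqP; split=> // c _ /=.
have [x /= Dx Bxy] := Dcov (coset_repr c) I.
by apply/mapP; exists x => //; rewrite -[c]coset_reprK; apply/esym/coset_projP.
Qed.

Definition quo_enum : seq quo := undup (projT1 (cid ((finite_seqP _).1 quo_finite))).

Lemma mem_quo_enum x : x \in quo_enum.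
Proof.
rewrite mem_undup; case: cid => s /= /seteqP[+ _].
by move=> /(_ x I).
Qed.

Definition quo_pickle x := index x quo_enum.
Definition quo_unpickle n := ohead (drop n quo_enum).

Lemma quo_pickleK : pcancel quo_pickle quo_unpickle.
Proof.
move=> x; rewrite /quo_unpickle (drop_nth x) /=.
  by rewrite nth_index ?mem_quo_enum.
by rewrite index_mem mem_quo_enum.
Qed.

HB.instance Definition _ := isCountable.Build quo quo_pickleK.

Lemma quo_enumP : Finite.axiom quo_enum.
Proof. by move=> x; rewrite count_uniq_mem ?undup_uniq// mem_quo_enum. Qed.

HB.instance Definition _ := isFinite.Build quo quo_enumP.

Definition quo_mul (x y : quo) := coset_proj (coset_repr x * coset_repr y)%g.
Definition quo_one := coset_proj 1%g.
Definition quo_inv (x : quo) := coset_proj (coset_repr x)^-1%g.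

Lemma quo_mulE x y : quo_mul (coset_proj x) (coset_proj y) = coset_proj (x * y)%g.
Proof.
have [_ [[_ UM _] UJ]] := openNormalP U.
apply/esym/coset_projP.
set a := coset_repr _; set b := coset_repr _.
have -> : ((x * y)^-1 * (a * b) = ((x^-1 * a) ^ y) * (y^-1 * b))%g.
  by rewrite conjgE invgM !mulgA mulgK.
by apply: UM; [apply: UJ|]; exact: coset_reprP.
Qed.

Lemma quo_mulA : associative quo_mul.
Proof.
move=> x y z; rewrite -(coset_reprK x) -(coset_reprK y) -(coset_reprK z).
rewrite (quo_mulE (coset_repr y)) (quo_mulE (coset_repr x) (coset_repr y)).
by rewrite !quo_mulE mulgA.
Qed.

Lemma quo_mul1 : left_id quo_one quo_mul.
Proof. by move=> x; rewrite -(coset_reprK x) quo_mulE mul1g. Qed.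

Lemma quo_mulV : left_inverse quo_one quo_inv quo_mul.
Proof. by move=> x; rewrite /quo_inv -{2}(coset_reprK x) quo_mulE mulVg. Qed.

HB.instance Definition _ :=
  Finite_isGroup.Build quo quo_mulA quo_mul1 quo_mulV.

Lemma coset_projM x y : coset_proj (x * y)%g = (coset_proj x * coset_proj y)%g.
Proof. by rewrite -quo_mulE. Qed.

Lemma coset_proj1 : coset_proj 1%g = 1%g.
Proof. by []. Qed.

End Quotient.

Section GroupAlgebra.
Variables (K : comNzRingType) (gT : finGroupType).

Definition galg := {ffun gT -> K^o}.
HB.instance Definition _ := GRing.Lmodule.copy galg {ffun gT -> K^o}.

Definition galg_of (g : gT) : galg := [ffun x => (x == g)%:R].
Definition galg_mul (a b : galg) : galg :=
  [ffun g => \sum_h a h * b (h^-1 * g)%g].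

Lemma galg_mulA : associative galg_mul.
Proof.
move=> a b c; apply/ffunP => g; rewrite !ffunE.
under eq_bigr do rewrite ffunE mulr_sumr.
under [RHS]eq_bigr do rewrite ffunE mulr_suml.
rewrite [RHS]exchange_big /=; apply: eq_bigr => h _.
rewrite (reindex_inj (mulgI h^-1%g)) /=; apply: eq_bigr => k _.
by rewrite mulrA invgM invgK -!mulgA mulVKg.
Qed.

Lemma galg_mul1l : left_id (galg_of 1%g) galg_mul.
Proof.
move=> a; apply/ffunP => g; rewrite ffunE (bigD1 1%g) //= ffunE eqxx mul1r.
rewrite invg1 mul1g big1 ?addr0// => h /negbTE h1.
by rewrite ffunE h1 mul0r.
Qed.

Lemma galg_mul1r : right_id (galg_of 1%g) galg_mul.
Proof.
move=> a; apply/ffunP => g; rewrite ffunE (bigD1 g) //= ffunE mulVg eqxx mulr1.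
rewrite big1 ?addr0// => h hg.
by rewrite ffunE -eq_mulVg1 (negbTE hg) mulr0.
Qed.

Lemma galg_mulDl : left_distributive galg_mul +%R.
Proof.
move=> a b c; apply/ffunP => g; rewrite !ffunE -big_split /=.
by apply: eq_bigr => h _; rewrite ffunE mulrDl.
Qed.

Lemma galg_mulDr : right_distributive galg_mul +%R.
Proof.
move=> a b c; apply/ffunP => g; rewrite !ffunE -big_split /=.
by apply: eq_bigr => h _; rewrite ffunE mulrDr.
Qed.

Lemma galg_1neq0 : galg_of 1%g != 0.
Proof.
by apply/eqP => /ffunP /(_ 1%g); rewrite !ffunE eqxx => /eqP; rewrite oner_eq0.
Qed.

HB.instance Definition _ := GRing.Zmodule_isNzRing.Build galg
  galg_mulA galg_mul1l galg_mul1r galg_mulDl galg_mulDr galg_1neq0.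

Lemma galg_mulE (a b : galg) g : (a * b) g = \sum_h a h * b (h^-1 * g)%g.
Proof. by rewrite ffunE. Qed.

Lemma galg_1E : 1 = galg_of 1%g.
Proof. by []. Qed.

Lemma galg_scaleAl (k : K) (a b : galg) : k *: (a * b) = (k *: a) * b.
Proof.
apply/ffunP => g; rewrite !ffunE [LHS]mulr_sumr.
by apply: eq_bigr => h _; rewrite ffunE; exact: mulrA.
Qed.

HB.instance Definition _ := GRing.Lmodule_isLalgebra.Build K galg galg_scaleAl.

Lemma galg_scaleAr (k : K) (a b : galg) : k *: (a * b) = a * (k *: b).
Proof.
apply/ffunP => g; rewrite !ffunE [LHS]mulr_sumr.
by apply: eq_bigr => h _; rewrite ffunE; exact: mulrCA.
Qed.

HB.instance Definition _ := GRing.Lalgebra_isAlgebra.Build K galg galg_scaleAr.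

Definition galg_aug (a : galg) : K := \sum_g a g.

End GroupAlgebra.

Section Pushforward.
Variables (K : comNzRingType) (gT hT : finGroupType) (f : gT -> hT).

Definition galg_push (a : galg K gT) : galg K hT :=
  [ffun y => \sum_(x | f x == y) a x].

Lemma galg_push_linear : linear galg_push.
Proof.
move=> k a b; apply/ffunP => y; rewrite !ffunE.
under eq_bigr do rewrite !ffunE.
by rewrite big_split /= scaler_sumr.
Qed.

HB.instance Definition _ :=
  GRing.isLinear.Build K (galg K gT) (galg K hT) *:%R galg_push galg_push_linear.

Lemma galg_push_of g : galg_push (galg_of K g) = galg_of K (f g).
Proof.
apply/ffunP => y; rewrite !ffunE big_mkcond /= (bigD1 g) //= ffunE eqxx.
rewrite big1 ?addr0 => [|x /negbTE xg]; last by rewrite ffunE xg; case: ifP.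
by rewrite eq_sym; case: eqP.
Qed.

Lemma galg_pushM : {morph f : x y / (x * y)%g} -> {morph galg_push : a b / a * b}.
Proof.
move=> fM a b; apply/ffunP => y; rewrite galg_mulE !ffunE.
have f1 : f 1%g = 1%g by apply: (@mulgI _ (f 1%g)); rewrite -fM !mulg1.
have fV x : f (x^-1)%g = ((f x)^-1)%g.
  by apply: (@mulgI _ (f x)); rewrite -fM !mulgV f1.
under eq_bigr do rewrite galg_mulE.
rewrite exchange_big /= (partition_big f xpredT) //=; apply: eq_bigr => z _.
rewrite ffunE mulr_suml; apply: eq_big => [x|x /eqP fx]; first by rewrite eq_sym.
rewrite ffunE mulr_sumr (reindex_inj (mulgI x)) /=.
apply: eq_big => [t|t _]; last by rewrite mulKg.
by rewrite fM fx -[in RHS](inj_eq (mulgI z)) mulVKg.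
Qed.

End Pushforward.

Lemma galg_push_comp (K : comNzRingType) (gT hT kT : finGroupType)
    (f : gT -> hT) (g : hT -> kT) (a : galg K gT) :
  galg_push g (galg_push f a) = galg_push (g \o f) a.
Proof.
apply/ffunP => z; rewrite !ffunE.
rewrite [RHS](partition_big f (fun y => g y == z)) //=.
apply: eq_bigr => y /eqP <-; rewrite ffunE; apply: eq_bigl => x.
by rewrite andb_idl// => /eqP ->.
Qed.

Lemma galg_aug_push (K : comNzRingType) (gT hT : finGroupType) (f : gT -> hT)
    (a : galg K gT) : galg_aug (galg_push f a) = galg_aug a.
Proof.
rewrite /galg_aug [RHS](partition_big f xpredT) //=.
by apply: eq_bigr => y _; rewrite ffunE.
Qed.

Section QuotientMap.
Variables (G H : profiniteGroupType) (f : {chom G -> H}).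
Variables (V : openNormal G) (U : openNormal H).

(* The homomorphism [G / V -> H / U] induced by [f]; it is meaningful when
   [V `<=` f @^-1` U]. *)
Definition quo_map (c : quo V) : quo U := coset_proj U (f (coset_repr c)).

Hypothesis sVU : V `<=` f @^-1` U.

Lemma quo_mapE x : quo_map (coset_proj V x) = coset_proj U (f x).
Proof.
have fM y z : f (y * z)%g = (f y * f z)%g by exact: gmulfM.
have f1 : f 1%g = 1%g by exact: gmulf1.
have fV y : f (y^-1)%g = ((f y)^-1)%g.
  by apply: (@mulgI _ (f y)); rewrite -fM !mulgV f1.
apply/esym/coset_projP; rewrite -fV -fM; apply: sVU; exact: coset_reprP.
Qed.

Lemma quo_mapM : {morph quo_map : x y / (x * y)%g}.
Proof.
move=> x y; rewrite -(coset_reprK x) -(coset_reprK y) -coset_projM !quo_mapE.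
by rewrite -coset_projM; congr coset_proj; exact: gmulfM.
Qed.

End QuotientMap.

Section IdHom.
Variable G : topologicalGroupType.
HB.instance Definition _ := isMultiplicative.Build G G idfun (fun _ _ => erefl).
HB.instance Definition _ :=
  Multiplicative_isUMagmaMorphism.Build G G idfun erefl.
Definition idhom : {chom G -> G} := idfun.
End IdHom.

Section CompletedGroupAlgebra.
Variables (K : comNzRingType) (G : profiniteGroupType).

(* The inverse limit of the group algebras [K[G / U]], [U] running over the open
   normal subgroups of [G]. *)
Definition coherent (a : forall U : openNormal G, galg K (quo U)) : Prop :=
  forall U V : openNormal G, V `<=` U ->
    galg_push (@quo_map G G (idhom G) V U) (a V) = a U.

Record cgalg := CGalg {
  cgalg_at :> forall U : openNormal G, galg K (quo U) ;
  cgalgP : coherent cgalg_at }.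

Lemma cgalg_eqP (a b : cgalg) : (forall U, a U = b U) -> a = b.
Proof.
case: a b => [a aP] [b bP] /= ab.
have eab : a = b by apply: functional_extensionality_dep.
by subst b; congr CGalg; exact: Prop_irrelevance.
Qed.

HB.instance Definition _ := gen_eqMixin cgalg.
HB.instance Definition _ := gen_choiceMixin cgalg.

Lemma quo_id_morph (U V : openNormal G) : V `<=` U ->
  {morph @quo_map G G (idhom G) V U : x y / (x * y)%g}.
Proof. by move=> sVU; exact: quo_mapM. Qed.

Lemma coherent0 : coherent (fun U => 0).
Proof. by move=> U V _; rewrite raddf0. Qed.
Lemma coherentN (a : cgalg) : coherent (fun U => - a U).
Proof. by move=> U V sVU; rewrite raddfN /= (cgalgP a sVU). Qed.
Lemma coherentD (a b : cgalg) : coherent (fun U => a U + b U).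
Proof. by move=> U V sVU; rewrite raddfD /= (cgalgP a sVU) (cgalgP b sVU). Qed.
Lemma coherentZ k (a : cgalg) : coherent (fun U => k *: a U).
Proof. by move=> U V sVU; rewrite linearZ /= (cgalgP a sVU). Qed.
Lemma coherent_of (g : G) : coherent (fun U => galg_of K (coset_proj U g)).
Proof. by move=> U V sVU; rewrite galg_push_of (quo_mapE (f := idhom G)). Qed.
Lemma coherentM (a b : cgalg) : coherent (fun U => a U * b U).
Proof.
move=> U V sVU; rewrite (galg_pushM (quo_id_morph sVU)).
by rewrite (cgalgP a sVU) (cgalgP b sVU).
Qed.

Definition cgalg0 := CGalg coherent0.
Definition cgalgN a := CGalg (coherentN a).
Definition cgalgD a b := CGalg (coherentD a b).
Definition cgalgZ k a := CGalg (coherentZ k a).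
Definition cgalgM a b := CGalg (coherentM a b).
Definition cgalg_of (g : G) := CGalg (coherent_of g).

Fact cgalg_addA : associative cgalgD.
Proof. by move=> a b c; apply: cgalg_eqP => U /=; rewrite addrA. Qed.
Fact cgalg_addC : commutative cgalgD.
Proof. by move=> a b; apply: cgalg_eqP => U /=; rewrite addrC. Qed.
Fact cgalg_add0 : left_id cgalg0 cgalgD.
Proof. by move=> a; apply: cgalg_eqP => U /=; rewrite add0r. Qed.
Fact cgalg_addN : left_inverse cgalg0 cgalgN cgalgD.
Proof. by move=> a; apply: cgalg_eqP => U /=; rewrite addNr. Qed.

HB.instance Definition _ :=
  GRing.isZmodule.Build cgalg cgalg_addA cgalg_addC cgalg_add0 cgalg_addN.

Fact cgalg_mulA : associative cgalgM.
Proof. by move=> a b c; apply: cgalg_eqP => U /=; rewrite mulrA. Qed.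
Fact cgalg_mul1l : left_id (cgalg_of 1%g) cgalgM.
Proof. by move=> a; apply: cgalg_eqP => U /=; exact: mul1r. Qed.
Fact cgalg_mul1r : right_id (cgalg_of 1%g) cgalgM.
Proof. by move=> a; apply: cgalg_eqP => U /=; exact: mulr1. Qed.
Fact cgalg_mulDl : left_distributive cgalgM cgalgD.
Proof. by move=> a b c; apply: cgalg_eqP => U /=; rewrite mulrDl. Qed.
Fact cgalg_mulDr : right_distributive cgalgM cgalgD.
Proof. by move=> a b c; apply: cgalg_eqP => U /=; rewrite mulrDr. Qed.
Fact cgalg_1neq0 : cgalg_of 1%g != 0.
Proof.
apply/eqP => /(congr1 (fun a : cgalg => a (openNormalT G))) /=.
by apply/eqP; exact: galg_1neq0.
Qed.

HB.instance Definition _ := GRing.Zmodule_isNzRing.Build cgalg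
  cgalg_mulA cgalg_mul1l cgalg_mul1r cgalg_mulDl cgalg_mulDr cgalg_1neq0.

Fact cgalg_scaleA j k a : cgalgZ j (cgalgZ k a) = cgalgZ (j * k) a.
Proof. by apply: cgalg_eqP => U /=; rewrite scalerA. Qed.
Fact cgalg_scale1 : left_id 1 cgalgZ.
Proof. by move=> a; apply: cgalg_eqP => U /=; rewrite scale1r. Qed.
Fact cgalg_scaleDr : right_distributive cgalgZ +%R.
Proof. by move=> k a b; apply: cgalg_eqP => U /=; rewrite scalerDr. Qed.
Fact cgalg_scaleDl a : {morph cgalgZ^~ a : j k / j + k}.
Proof. by move=> j k; apply: cgalg_eqP => U /=; rewrite scalerDl. Qed.

HB.instance Definition _ := GRing.Zmodule_isLmodule.Build K cgalg
  cgalg_scaleA cgalg_scale1 cgalg_scaleDr cgalg_scaleDl.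

Fact cgalg_scaleAl (k : K) (a b : cgalg) : k *: (a * b) = (k *: a) * b.
Proof. by apply: cgalg_eqP => U /=; exact: scalerAl. Qed.

HB.instance Definition _ := GRing.Lmodule_isLalgebra.Build K cgalg cgalg_scaleAl.

Fact cgalg_scaleAr (k : K) (a b : cgalg) : k *: (a * b) = a * (k *: b).
Proof. by apply: cgalg_eqP => U /=; exact: scalerAr. Qed.

HB.instance Definition _ := GRing.Lalgebra_isAlgebra.Build K cgalg cgalg_scaleAr.

(* [G / G] is trivial; [galg_aug_push] shows that any other [U] gives the same
   value. *)
Definition cgalg_aug (a : cgalg) : K := galg_aug (a (openNormalT G)).

End CompletedGroupAlgebra.

Section CompletedPushforward.
Variables (K : comNzRingType) (G H : profiniteGroupType) (f : {chom G -> H}).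

Lemma cgalg_push_coherent (a : cgalg K G) :
  coherent (fun U : openNormal H =>
    galg_push (@quo_map G H f _ U) (a (openNormal_preimage f U))).
Proof.
move=> U V sVU.
have sVU' : openNormal_preimage f V `<=` openNormal_preimage f U.
  by move=> x /=; exact: sVU.
rewrite -(cgalgP a sVU') !galg_push_comp; congr (galg_push _ _).
apply/funext => c /=; rewrite -(coset_reprK c).
rewrite (quo_mapE (f := f)) // (quo_mapE (f := idhom _)) //=.
by rewrite (quo_mapE (f := idhom _)) //= (quo_mapE (f := f)).
Qed.

Definition cgalg_push (a : cgalg K G) : cgalg K H :=
  CGalg (cgalg_push_coherent a).

End CompletedPushforward.

Section NonCommutativePowerSeries.
Variables (K : comNzRingType) (d : nat).

(* Formal power series in the non-commuting variables [x_j], [j : 'I_d]: [f w] is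
   the coefficient of the monomial spelled by the word [w]. *)
Definition ncps := seq 'I_d -> K^o.
HB.instance Definition _ := GRing.Lmodule.copy ncps (seq 'I_d -> K^o).

Definition ncps_one : ncps := fun w => (w == [::])%:R.
Definition ncpsX (j : 'I_d) : ncps := fun w => (w == [:: j])%:R.
Definition ncps_mul (f g : ncps) : ncps :=
  fun w => \sum_(i < (size w).+1) f (take i w) * g (drop i w).

Lemma ncps_mul_nil f g : ncps_mul f g [::] = f [::] * g [::].
Proof. by rewrite /ncps_mul big_ord_recl big_ord0 addr0. Qed.

Lemma ncps_mul_cons f g x w :
  ncps_mul f g (x :: w) =
  f [::] * g (x :: w) + ncps_mul (fun u => f (x :: u)) g w.
Proof. by rewrite /ncps_mul big_ord_recl. Qed.

Lemma ncps_addE (f g : ncps) w : (f + g) w = f w + g w.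
Proof. by []. Qed.

Fact ncps_mulDl : left_distributive ncps_mul +%R.
Proof.
move=> f g h; apply/funext => w; rewrite ncps_addE -big_split /=.
by apply: eq_bigr => i _; rewrite ncps_addE mulrDl.
Qed.

Fact ncps_mulDr : right_distributive ncps_mul +%R.
Proof.
move=> f g h; apply/funext => w; rewrite ncps_addE -big_split /=.
by apply: eq_bigr => i _; rewrite ncps_addE mulrDr.
Qed.

Lemma ncps_mulZl (k : K) (f g : ncps) w :
  ncps_mul (fun u => k * f u) g w = k * ncps_mul f g w.
Proof. by rewrite [RHS]mulr_sumr; apply: eq_bigr => i _; rewrite mulrA. Qed.

Fact ncps_mulA : associative ncps_mul.
Proof.
move=> f g h; apply/funext => w; elim: w f g h => [|x w IH] f g h.
  by rewrite !ncps_mul_nil mulrA.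
rewrite !ncps_mul_cons ncps_mul_nil IH mulrDr -mulrA -addrA; congr (_ + _).
rewrite -ncps_mulZl -ncps_addE.
have -> : (fun u => ncps_mul f g (x :: u)) =
   (fun u => f [::] * g (x :: u)) + ncps_mul (fun u => f (x :: u)) g :> ncps.
  by apply/funext => u; rewrite ncps_mul_cons.
by rewrite ncps_mulDl.
Qed.

Fact ncps_mul1l : left_id ncps_one ncps_mul.
Proof.
move=> f; apply/funext => -[|x w]; first by rewrite ncps_mul_nil mul1r.
rewrite ncps_mul_cons mul1r [X in _ + X]big1 ?addr0// => i _.
by rewrite mul0r.
Qed.

Fact ncps_mul1r : right_id ncps_one ncps_mul.
Proof.
move=> f; apply/funext => w; elim: w f => [|x w IH] f.
  by rewrite ncps_mul_nil mulr1.
by rewrite ncps_mul_cons IH mulr0 add0r.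
Qed.

Fact ncps_1neq0 : ncps_one != 0.
Proof.
by apply/eqP => /(congr1 (fun f : ncps => f [::])) /eqP; rewrite oner_eq0.
Qed.

HB.instance Definition _ := GRing.Zmodule_isNzRing.Build ncps
  ncps_mulA ncps_mul1l ncps_mul1r ncps_mulDl ncps_mulDr ncps_1neq0.

Fact ncps_scaleAl (k : K) (f g : ncps) : k *: (f * g) = (k *: f) * g.
Proof. by apply/funext => w; apply/esym/ncps_mulZl. Qed.

HB.instance Definition _ := GRing.Lmodule_isLalgebra.Build K ncps ncps_scaleAl.

Fact ncps_scaleAr (k : K) (f g : ncps) : k *: (f * g) = f * (k *: g).
Proof.
apply/funext => w; rewrite [LHS]mulr_sumr.
by apply: eq_bigr => i _; rewrite mulrCA.
Qed.

HB.instance Definition _ := GRing.Lalgebra_isAlgebra.Build K ncps ncps_scaleAr.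

(* The unique family with [f = \sum_j fox j f * x_j] when [f] has no constant
   term: see [fox_decomp] and [fox_unique]. *)
Definition fox (j : 'I_d) (f : ncps) : ncps := fun w => f (rcons w j).

Lemma mul_ncpsX_rcons (f : ncps) j w k :
  (f * ncpsX j) (rcons w k) = f w * (k == j)%:R.
Proof.
elim: w f => [|x w IH] f.
  by rewrite [LHS]ncps_mul_cons ncps_mul_nil mulr0 addr0 /ncpsX eqseq_cons andbT.
rewrite [LHS]ncps_mul_cons [X in _ + X]IH /ncpsX eqseq_cons.
by case: w {IH} => [|y w]; rewrite andbF mulr0 add0r.
Qed.

Lemma mul_ncpsX_nil (f : ncps) j : (f * ncpsX j) [::] = 0.
Proof. by rewrite [LHS]ncps_mul_nil mulr0. Qed.

Lemma ncps_sumE (I : Type) (s : seq I) (P : pred I) (F : I -> ncps) w :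
  (\sum_(i <- s | P i) F i) w = \sum_(i <- s | P i) F i w.
Proof. by elim/big_rec2: _ => // i y f _ <-. Qed.

Lemma fox_sum (D : 'I_d -> ncps) k : fox k (\sum_j D j * ncpsX j) = D k.
Proof.
apply/funext => w; rewrite /fox ncps_sumE (bigD1 k) //=.
rewrite mul_ncpsX_rcons eqxx mulr1 big1 ?addr0// => j /negbTE jk.
by rewrite mul_ncpsX_rcons eq_sym jk mulr0.
Qed.

Lemma fox_decomp (f : ncps) : f [::] = 0 -> f = \sum_j fox j f * ncpsX j.
Proof.
move=> f0; apply/funext => w; case/lastP: w => [|w k].
  by rewrite ncps_sumE big1 // => j _; rewrite mul_ncpsX_nil.
by rewrite -[LHS]/(fox k f w) -[RHS]/(fox k _ w) fox_sum.
Qed.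

Lemma fox_unique (f : ncps) (D : 'I_d -> ncps) :
  f = \sum_j D j * ncpsX j -> forall j, D j = fox j f.
Proof. by move=> -> j; rewrite fox_sum. Qed.

End NonCommutativePowerSeries.

Section IdealPowers.
Variable R : pzRingType.

Definition ideal_mul (I J : set R) : set R :=
  [set x | exists2 s : seq (R * R),
     forall ab, ab \in s -> I ab.1 /\ J ab.2
   & x = \sum_(ab <- s) ab.1 * ab.2].

Fixpoint ideal_pow (I : set R) (n : nat) : set R :=
  if n is m.+1 then ideal_mul (ideal_pow I m) I else setT.

End IdealPowers.

Section Dimension.
Variables (K : fieldType) (V : lmodType K).

Definition quot_dim_is (A B : set V) (n : nat) : Prop :=
  exists e : 'I_n -> V,
    [/\ forall i, A (e i),
        forall u, A u -> exists c : 'I_n -> K, B (u - \sum_i c i *: e i)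
      & forall c : 'I_n -> K, B (\sum_i c i *: e i) -> forall i, c i = 0].

(* The dimension of [A / B] for subspaces [B `<=` A]; zero by convention if it is
   infinite. *)
Definition quot_dim (A B : set V) : nat := xget 0%N (quot_dim_is A B).

End Dimension.

Section Cohomology.
Variables (K : fieldType) (G : topologicalGroupType).

(* Continuity for the discrete topology on [K]. *)
Definition locally_constant (T : topologicalType) (f : T -> K) : Prop :=
  forall a, open (f @^-1` [set a]).

(* Coboundaries of the inhomogeneous cochain complex with values in the trivial
   module [K]; there the coboundary of a 0-cochain vanishes. *)
Definition cobound1 (f : G -> K^o) : G * G -> K^o :=
  fun x => f x.2 - f (x.1 * x.2)%g + f x.1.
Definition cobound2 (f : G * G -> K^o) : G * G * G -> K^o :=
  fun x => let: (g, h, k) := x in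
    f (h, k) - f ((g * h)%g, k) + f (g, (h * k)%g) - f (g, h).

Definition cocycles1 : set (G -> K^o) :=
  [set f | locally_constant f /\ cobound1 f = 0].
Definition coboundaries1 : set (G -> K^o) := [set 0].
Definition cocycles2 : set (G * G -> K^o) :=
  [set f | locally_constant f /\ cobound2 f = 0].
Definition coboundaries2 : set (G * G -> K^o) :=
  cobound1 @` [set b | locally_constant b].

Definition dim_H1_is (n : nat) := quot_dim_is cocycles1 coboundaries1 n.
Definition dim_H2_is (n : nat) := quot_dim_is cocycles2 coboundaries2 n.

End Cohomology.

Section DimensionSubgroups.
Variables (K : comNzRingType) (H : profiniteGroupType).

Definition aug_ideal : set (cgalg K H) := [set a | cgalg_aug a = 0].

Definition dim_subgroup (n : nat) : set H :=
  [set h | ideal_pow aug_ideal n (cgalg_of K h - 1)].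

Definition level_is (h : H) (n : nat) : Prop :=
  dim_subgroup n h /\ forall m, dim_subgroup m h -> (m <= n)%N.

End DimensionSubgroups.

Definition pro_p (p : nat) (G : profiniteGroupType) : Prop :=
  forall U : openNormal G, p.-nat #|{: quo U}|.

Definition free_pro_p (p d : nat) (F : profiniteGroupType) (sigma : 'I_d -> F)
    : Prop :=
  pro_p p F /\
  forall (H : profiniteGroupType) (h : 'I_d -> H), pro_p p H ->
    exists f : {chom F -> H}, (forall i, f (sigma i) = h i) /\
      forall g : {chom F -> H}, (forall i, g (sigma i) = h i) ->
        forall x, g x = f x.

Definition minimal_for (I : Type) (P : set I -> Prop) (A : set I) : Prop :=
  P A /\ forall B, B `<` A -> ~ P B.

Definition ker (F G : topologicalGroupType) (phi : F -> G) : set F :=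
  [set x | phi x = 1%g].

Section Presentation.
Variables (p d r : nat) (G F : profiniteGroupType).
Variables (sigma : 'I_d -> F) (phi : {chom F -> G}) (rho : 'I_r -> F).

Record minimal_presentation : Prop := {
  presentation_free : free_pro_p p sigma ;
  presentation_surj : forall g, exists x, phi x = g ;
  presentation_gens : minimal_for
    (fun A => smallest (@closed_subgroup G) ((phi \o sigma) @` A) = setT) setT ;
  presentation_rels : exists R : 'I_r -> F,
    smallest (@closed_normal_subgroup F) (range R) = ker phi }.

(* [rels_generate_mod n A]: the images of the [rho i], [i] in [A], generate
   R F_n / F_n as a normal subgroup of F / F_n; stated through preimages in F. *)
Definition rels_generate_mod (n : nat) (A : set 'I_r) : Prop :=
  smallest (@normal_subgroup F) (rho @` A `|` dim_subgroup 'F_p n) =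
  [set (x * y)%g | x in ker phi & y in dim_subgroup 'F_p n].

(* [v i] is the level of [rho i], so that [[set i | v i <= n]] indexes S_n. *)
Record adapted_relations (v : 'I_r -> nat) : Prop := {
  adapted_rel : forall i, phi (rho i) = 1%g ;
  adapted_defining :
    smallest (@closed_normal_subgroup F) (range rho) = ker phi ;
  adapted_level : forall i, level_is 'F_p (rho i) (v i) ;
  adapted_minimal : forall n,
    minimal_for (rels_generate_mod n.+1) [set i | (v i <= n)%N] }.

Definition num_rels (v : 'I_r -> nat) (k : nat) : nat :=
  if k is 0%N then 1%N else #|[pred i | v i == k]|.

(* Isomorphisms of topological algebras F_p[[F]] -> F_p<<x_1, ..., x_d>> with
   sigma_j |-> 1 + x_j; there is exactly one when F is free on sigma. *)
Definition magnus_iso (theta : cgalg 'F_p F -> ncps 'F_p d) : Prop :=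
  [/\ bijective theta, linear theta, monoid_morphism theta,
      (forall n, exists U : openNormal F, forall a : cgalg 'F_p F,
         a U = 0 -> forall w, (size w < n)%N -> theta a w = 0)
    & forall j, theta (cgalg_of _ (sigma j)) = 1 + ncpsX _ j].

Definition magnus : cgalg 'F_p F -> ncps 'F_p d := xget (fun=> 0) magnus_iso.
Definition magnus_inv (f : ncps 'F_p d) : cgalg 'F_p F :=
  xget 0 (magnus @^-1` [set f]).

Definition jacobian (i : 'I_r) (j : 'I_d) : cgalg 'F_p G :=
  cgalg_push phi (magnus_inv (fox j (magnus (cgalg_of _ (rho i) - 1)))).

Definition jacobian_map (g : {ffun 'I_r -> cgalg 'F_p G})
    : {ffun 'I_d -> cgalg 'F_p G} :=
  [ffun j => \sum_i g i * jacobian i j].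

Definition aug_quot_dim (n : nat) : nat :=
  quot_dim [set: cgalg 'F_p G] (ideal_pow (@aug_ideal 'F_p G) n).

(* With M = \bigoplus_i I^(n - v i) and N = \bigoplus_j I^(n - 1), the kernel of
   the map A^r / M -> A^d / N induced by [jacobian_map] is its preimage of N,
   modulo M. Truncated subtraction agrees with I^m = A for m <= 0. *)
Definition jacobian_ker_dim (v : 'I_r -> nat) (n : nat) : nat :=
  quot_dim
    [set g | forall j, ideal_pow (@aug_ideal 'F_p G) (n - 1) (jacobian_map g j)]
    [set g : {ffun 'I_r -> cgalg 'F_p G} |
      forall i, ideal_pow (@aug_ideal 'F_p G) (n - v i) (g i)].

End Presentation.

(* Main.v *)
(**
  Write P for the power series ring and Pi : P -> A = F_p[[G]] for the composite
  of the inverse Magnus isomorphism with F_p[[F]] -> F_p[[G]]. The map Pi is onto,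
  I^n is the image of the series of order at least n, and modulo such series the
  kernel of Pi is the ideal generated by the f_i. Since every element of the
  augmentation ideal is a sum of a_j x_j, this makes the sequence
    sum_i A/I^(n - v_i) -- J_n --> sum_j A/I^(n-1) -- (x_j) --> I/I^n --> 0
  exact: a right factor of f_i can be absorbed, up to elements of the kernel times
  the x_j, so that only left multiples of the f_i matter. The formula is the
  alternating sum of the dimensions.

  The Magnus isomorphism is built from both sides. Substituting sigma_j - 1 for
  x_j converges in F_p[F/U] because the augmentation ideal of a finite p-group is
  nilpotent; conversely sigma_j |-> 1 + x_j extends to F because the one-units of
  the truncated power series ring form a finite p-group. The composites are the
  identity by the recursion f = f(1) + sum_j x_j f_j and by the uniqueness part of
  the universal property.
*)

From HB Require Import structures.
From mathcomp Require Import all_boot all_fingroup all_algebra.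
From mathcomp Require Import pgroup abelian mxrepresentation mxabelem.
From mathcomp Require Import boolp classical_sets functions cardinality filter topology.
Require Import Defs.

Set Implicit Arguments.
Unset Strict Implicit.
Unset Printing Implicit Defensive.

Import GRing.Theory.
Local Open Scope classical_set_scope.
Local Open Scope ring_scope.

(** * Dimensions of subquotients *)

Section QuotientDimension.
Variable K : fieldType.

Definition subspace (V : lmodType K) (A : set V) :=
  A 0 /\ forall (k : K) x y, A x -> A y -> A (k *: x + y).

Section Subspace.
Variables (V : lmodType K) (A : set V).
Hypothesis sA : subspace A.

Lemma subspaceD x y : A x -> A y -> A (x + y).
Proof. by move=> Ax Ay; have := sA.2 1 _ _ Ax Ay; rewrite scale1r. Qed.

Lemma subspaceZ k x : A x -> A (k *: x).
Proof. by move=> Ax; have := sA.2 k _ _ Ax sA.1; rewrite addr0. Qed.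

Lemma subspaceN x : A x -> A (- x).
Proof. by rewrite -scaleN1r; exact: subspaceZ. Qed.

Lemma subspaceB x y : A x -> A y -> A (x - y).
Proof. by move=> Ax /subspaceN; exact: subspaceD. Qed.

Lemma subspace_sum (I : Type) (s : seq I) (P : pred I) (F : I -> V) :
  (forall i, P i -> A (F i)) -> A (\sum_(i <- s | P i) F i).
Proof. by move=> AF; elim/big_rec: _ => [|i x /AF]; [exact: sA.1 | exact: subspaceD]. Qed.

End Subspace.

Lemma subspaceT (V : lmodType K) : subspace [set: V].
Proof. by []. Qed.

(** Together with [independent_mod] this splits [quot_dim_is] into two halves, so that each
    inequality between dimensions can use one half only. The spanning vectors may lie outside
    [A]. *)
Definition spanned_mod (V : lmodType K) (A B : set V) n := exists e : 'I_n -> V,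
  forall u, A u -> exists c : 'I_n -> K, B (u - \sum_i c i *: e i).

Definition independent_mod (V : lmodType K) (A B : set V) n := exists2 e : 'I_n -> V,
  forall i, A (e i)
  & forall c : 'I_n -> K, B (\sum_i c i *: e i) -> forall i, c i = 0.

(** Steinitz's bound: the matrix expressing [m] vectors by [n < m] spanning ones has a nonzero row
    in its left kernel, which is a linear relation modulo [B]. *)
Lemma independent_mod_le (V : lmodType K) (A B : set V) m n : subspace B ->
  spanned_mod A B n -> independent_mod A B m -> (m <= n)%N.
Proof.
move=> sB [e eP] [f Af fP].
have /choice[c cP] : forall i, exists c : 'I_n -> K, B (f i - \sum_j c j *: e j).
  by move=> i; exact: eP.
pose C : 'M[K]_(m, n) := \matrix_(i, j) c i j.
rewrite leqNgt; apply/negP => ltnm.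
have : kermx C != 0.
  rewrite -mxrank_eq0 mxrank_ker subn_eq0 -ltnNge.
  by rewrite (leq_ltn_trans (rank_leq_col C)).
case/rowV0Pn => k /sub_kermxP kC /eqP; apply; apply/rowP => i; rewrite mxE.
apply: (fP (fun i => k ord0 i)).
have -> : \sum_i k ord0 i *: f i =
          \sum_i k ord0 i *: (f i - \sum_j c i j *: e j).
  under [RHS]eq_bigr do rewrite scalerBr.
  rewrite sumrB [X in _ - X](_ : _ = 0) ?subr0//.
  under eq_bigr do rewrite scaler_sumr.
  rewrite exchange_big big1 //= => j _.
  under eq_bigr do rewrite scalerA.
  have kCj : \sum_i k ord0 i * c i j = (k *m C) ord0 j.
    by rewrite mxE; apply: eq_bigr => l _; rewrite mxE.
  by rewrite -scaler_suml kCj kC mxE scale0r.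
by apply: subspace_sum => // l _; apply: subspaceZ.
Qed.

Lemma quot_dim_is_spanned (V : lmodType K) (A B : set V) n :
  quot_dim_is A B n -> spanned_mod A B n.
Proof. by case=> e [_ ? _]; exists e. Qed.

Lemma quot_dim_is_independent (V : lmodType K) (A B : set V) n :
  quot_dim_is A B n -> independent_mod A B n.
Proof. by case=> e [? _ ?]; exists e. Qed.

Lemma quot_dim_is_unique (V : lmodType K) (A B : set V) m n : subspace B ->
  quot_dim_is A B m -> quot_dim_is A B n -> m = n.
Proof.
move=> sB Am An; apply/eqP; rewrite eqn_leq.
rewrite (independent_mod_le sB (quot_dim_is_spanned An) (quot_dim_is_independent Am)).
by rewrite (independent_mod_le sB (quot_dim_is_spanned Am) (quot_dim_is_independent An)).
Qed.

(** The bound [N] lets one choose an independent family of maximal size; such a family spans. *)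
Lemma quot_dim_is_exists (V : lmodType K) (A B : set V) N : subspace B ->
  (forall m, independent_mod A B m -> (m <= N)%N) -> exists n, quot_dim_is A B n.
Proof.
move=> sB bnd.
have ex0 : exists m, `[< independent_mod A B m >].
  exists 0%N; apply/asboolP; exists (fun=> 0) => [[]|? ? []] //.
have bnd' m : `[< independent_mod A B m >] -> (m <= N)%N by move/asboolP/bnd.
case: (ex_maxnP ex0 bnd') => n /asboolP[e Ae eP] nmax.
exists n, e; split=> // u Au; apply: contrapT => nu.
suff /asboolP/nmax : independent_mod A B n.+1 by rewrite ltnn.
exists (fun i => if unlift ord0 i is Some j then e j else u) => [i|c].
  by case: unliftP.
rewrite big_ord_recl unlift_none; under eq_bigr do rewrite liftK.
(* A nonzero coefficient of [u] could be inverted, putting [u] in the span of the [e i] modulo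
   [B]. *)
move=> Bc; have c0 : c ord0 = 0.
  apply/eqP/negP => /negP c0; apply: nu.
  exists (fun i => - (c ord0)^-1 * c (lift ord0 i)).
  have := subspaceZ sB (c ord0)^-1 Bc.
  rewrite scalerDr scalerA mulVf// scale1r scaler_sumr.
  congr (B (_ + _)); rewrite -sumrN; apply: eq_bigr => i _.
  by rewrite scalerA mulNr scaleNr opprK.
have {}Bc : B (\sum_i c (lift ord0 i) *: e i) by move: Bc; rewrite c0 scale0r add0r.
by move=> i; case: (unliftP ord0 i) => [j|] -> //; exact: eP Bc j.
Qed.

Lemma quot_dim_is_spanned_exists (V : lmodType K) (A B : set V) N :
  subspace B -> spanned_mod A B N -> exists n, quot_dim_is A B n.
Proof.
by move=> sB sp; apply: (@quot_dim_is_exists _ _ _ N) => // m; exact: independent_mod_le.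
Qed.

Lemma quot_dim_is_xget (V : lmodType K) (A B : set V) n :
  subspace B -> quot_dim_is A B n -> quot_dim A B = n.
Proof.
move=> sB An; rewrite /quot_dim; case: xgetP => [m _|/(_ n)//].
by move=> Am; exact: quot_dim_is_unique Am An.
Qed.

Lemma quot_dim_isP (V : lmodType K) (A B : set V) :
  (exists n, quot_dim_is A B n) -> quot_dim_is A B (quot_dim A B).
Proof. by case=> n An; rewrite /quot_dim; case: xgetP => [m _ //|/(_ n)]. Qed.

Lemma quot_dim_is_refl (V : lmodType K) (A B : set V) :
  A `<=` B -> quot_dim_is A B 0.
Proof.
move=> AB; exists (fun=> 0); split=> [[]//|u /AB Bu|? ? []//].
by exists (fun=> 0); rewrite big_ord0 subr0.
Qed.

Lemma quot_dim_is_add (V : lmodType K) (A B C : set V) m n :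
  subspace B -> C `<=` B -> subspace C -> B `<=` A ->
  quot_dim_is A B m -> quot_dim_is B C n -> quot_dim_is A C (m + n).
Proof.
move=> sB CB sC BA [e [Ae eS eI]] [f [Bf fS fI]].
exists (fun i => match fintype.split i with inl i => e i | inr j => f j end).
have sumE (c : 'I_(m + n) -> K) :
  \sum_i c i *: match fintype.split i with inl i => e i | inr j => f j end =
  \sum_i c (lshift n i) *: e i + \sum_j c (rshift m j) *: f j.
  rewrite big_split_ord /=; congr (_ + _); apply: eq_bigr => i _.
    by rewrite (fintype.unsplitK (inl i)).
  by rewrite (fintype.unsplitK (inr i)).
split=> [i|u Au|c].
- by case: fintype.split => j; [exact: Ae | exact/BA/Bf].
- have [c Bc] := eS _ Au; have [b Cb] := fS _ Bc.
  exists (fun i => match fintype.split i with inl i => c i | inr j => b j end).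
  rewrite sumE opprD addrA; congr (C (_ - _ - _)): Cb; apply: eq_bigr => i _.
    by rewrite (fintype.unsplitK (inl i)).
  by rewrite (fintype.unsplitK (inr i)).
- rewrite sumE => Cc.
  have c0 i : c (lshift n i) = 0.
    apply: (eI (fun i => c (lshift n i))).
    rewrite -[X in B X](addrK (\sum_j c (rshift m j) *: f j)).
    by apply: (subspaceB sB (CB _ Cc)); apply: subspace_sum => // j _; exact: subspaceZ.
  move: Cc; rewrite big1 ?add0r => [/fI d0|i _]; last by rewrite c0 scale0r.
  by move=> i; rewrite -(fintype.splitK i); case: fintype.split => j /=.
Qed.

(** Families independent in [A] modulo [B], or in [B] modulo [C], are also independent in [A] modulo
    [C]; this bounds both sizes by [n] and gives the two dimensions. *)
Lemma quot_dim_is_sub (V : lmodType K) (A B C : set V) n :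
  subspace B -> C `<=` B -> subspace C -> B `<=` A -> quot_dim_is A C n ->
  exists k l, [/\ quot_dim_is A B k, quot_dim_is B C l & n = (k + l)%N].
Proof.
move=> sB CB sC BA An.
have bnd := independent_mod_le sC (quot_dim_is_spanned An).
have [k Ak] : exists k, quot_dim_is A B k.
  apply: (@quot_dim_is_exists _ _ _ n) => // m [e Ae eI]; apply: bnd.
  by exists e => // c /CB; exact: eI.
have [l Al] : exists l, quot_dim_is B C l.
  apply: (@quot_dim_is_exists _ _ _ n) => // m [e Be eI]; apply: bnd.
  by exists e => // i; exact/BA/Be.
exists k, l; split=> //.
exact: (quot_dim_is_unique sC An (quot_dim_is_add sB CB sC BA Ak Al)).
Qed.

(** The three conditions on [L] say that it induces a well-defined bijection from [A / B] to
    [A' / B'], so it carries a basis to a basis. *)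
Lemma quot_dim_is_iso (V W : lmodType K) (A B : set V) (A' B' : set W)
    (L : V -> W) n :
  linear L -> subspace B' -> subspace A ->
  (forall x, A x -> A' (L x)) ->
  (forall y, A' y -> exists2 x, A x & B' (y - L x)) ->
  (forall x, A x -> B x <-> B' (L x)) ->
  quot_dim_is A B n -> quot_dim_is A' B' n.
Proof.
move=> linL sB' sA LA LS LB [e [Ae eS eI]].
pose Lm : {linear V -> W} := HB.pack L (GRing.isLinear.Build _ _ _ _ L linL).
have LsumE c : L (\sum_i c i *: e i) = \sum_i c i *: L (e i).
  by rewrite -[L]/(Lm : V -> W) linear_sum; apply: eq_bigr => i _; rewrite linearZ.
have Asum (c : 'I_n -> K) : A (\sum_i c i *: e i).
  by apply: subspace_sum => // i _; exact: subspaceZ.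
exists (L \o e); split=> /= [i|y A'y|c].
- exact: LA.
- have [x Ax B'x] := LS _ A'y; have [c Bc] := eS _ Ax; exists c.
  rewrite -LsumE -(subrK (L x) y) -addrA; apply: (subspaceD sB') => //.
  rewrite -[L]/(Lm : V -> W) -linearB; apply/LB => //; exact: subspaceB.
- by rewrite -LsumE => /LB => /(_ (Asum c)); exact: eI.
Qed.

Lemma quot_dim_is_ffun (V : lmodType K) (r : nat) (B : 'I_r -> set V) (m : 'I_r -> nat) :
  (forall i, subspace (B i)) -> (forall i, quot_dim_is setT (B i) (m i)) ->
  quot_dim_is [set: {ffun 'I_r -> V}] [set g | forall i, B i (g i)] (\sum_i m i)%N.
Proof.
move=> sB dB.
(* The filtration by coordinates: passing from [M t] to [M t.+1] constrains only the coordinate [t]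
   and adds its dimension. *)
pose M t := [set g : {ffun 'I_r -> V} | forall i : 'I_r, (i < t)%N -> B i (g i)].
have sM t : subspace (M t).
  split=> [i _|k x y Mx My i it]; rewrite !ffunE; first exact: (sB i).1.
  by apply: (sB i).2; [exact: Mx | exact: My].
have dM t : (t <= r)%N -> quot_dim_is setT (M t) (\sum_(i < r | (i < t)%N) m i)%N.
  elim: t => [_|t IH ltr].
    by rewrite big_pred0 //; apply: quot_dim_is_refl => g _ i.
  pose i0 := Ordinal ltr.
  rewrite (bigD1 i0) //= addnC.
  rewrite (eq_bigl (fun i : 'I_r => (i < t)%N)); last first.
    by move=> i; rewrite -val_eqE /= andbC [RHS]ltn_neqAle.
  apply: (quot_dim_is_add (sM t)) => //.
  - by move=> g Mg i it; apply: Mg; exact: ltnW.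
  - by apply: IH; exact: ltnW.
  (* The inclusion of [V] as coordinate [i0] identifies [V / B i0] with [M t / M t.+1]. *)
  have := dB i0; apply: (quot_dim_is_iso
    (L := fun v => [ffun i => if i == i0 then v else 0])) => //.
  - by move=> k x y; apply/ffunP => i; rewrite !ffunE; case: ifP; rewrite ?scaler0 ?addr0.
  - move=> v _ i it; rewrite ffunE -val_eqE /= ltn_eqF //; exact: (sB i).1.
  - move=> g Mg; exists (g i0) => // i; rewrite ltnS leq_eqVlt => /orP[/eqP it|it].
      rewrite !ffunE (_ : i = i0) ?eqxx ?subrr; last exact: val_inj.
      exact: (sB _).1.
    by rewrite !ffunE -val_eqE /= ltn_eqF // subr0; exact: Mg.
  - move=> v _; split=> [Bv i|/(_ i0)]; last by rewrite ffunE eqxx; exact.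
    by rewrite ffunE; case: eqP => [-> //|_ _]; exact: (sB i).1.
have -> : (\sum_i m i = \sum_(i < r | i < r) m i)%N.
  by apply: eq_bigl => i; rewrite ltn_ord.
have := dM r (leqnn r); congr quot_dim_is.
by apply/seteqP; split=> g /= Mg i => [|_]; exact: Mg.
Qed.

End QuotientDimension.

(** * Group algebras of finite p-groups *)

Section GroupAlgebraBasis.
Variables (K : comNzRingType) (gT : finGroupType).

Lemma galg_ofM (g h : gT) : galg_of K (g * h)%g = galg_of K g * galg_of K h.
Proof.
apply/ffunP => x; rewrite galg_mulE ffunE (bigD1 g) //= !ffunE eqxx mul1r.
rewrite big1 ?addr0 => [|y /negbTE yg]; last by rewrite ffunE yg mul0r.
by rewrite -[in RHS](inj_eq (mulgI g)) mulVKg.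
Qed.

Lemma galg_sum_of (a : galg K gT) : a = \sum_g a g *: galg_of K g.
Proof.
apply/ffunP => x; rewrite sum_ffunE (bigD1 x) //= !ffunE eqxx big1 ?addr0.
  by rewrite [RHS]mulr1.
by move=> y /negbTE yx; rewrite !ffunE eq_sym yx; exact: mulr0.
Qed.

End GroupAlgebraBasis.

Section GroupAlgebraOfPGroup.
Variables (K : fieldType) (gT : finGroupType).
Local Notation GT := [set: gT]%SET.

Section Representation.
Variables (n : nat) (rG : mx_representation K GT n).

Definition galg_op (a : galg K gT) : 'M[K]_n := \sum_g a g *: rG g.

Lemma galg_op1 : galg_op 1 = 1%:M.
Proof.
rewrite /galg_op (bigD1 1%g) //= ffunE eqxx scale1r repr_mx1 big1 ?addr0//.
by move=> g /negbTE g1; rewrite ffunE g1 scale0r.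
Qed.

Lemma galg_opM a b : galg_op (a * b) = galg_op a *m galg_op b.
Proof.
rewrite /galg_op mulmx_suml.
under eq_bigr do rewrite galg_mulE scaler_suml.
rewrite exchange_big /=; apply: eq_bigr => g _; rewrite mulmx_sumr.
rewrite (reindex_inj (mulgI g)) /=; apply: eq_bigr => h _.
by rewrite mulKg repr_mxM ?inE// -scalemxAl -scalemxAr scalerA.
Qed.

Lemma galg_op_prod s a :
  foldl (fun W b => W *m galg_op b) (galg_op a) s = galg_op (a * \prod_(b <- s) b).
Proof.
elim: s a => [|b s IH] a; first by rewrite big_nil mulr1.
by rewrite big_cons mulrA -IH galg_opM.
Qed.

End Representation.

Variable p : nat.
Hypotheses (pcharK : p \in [pchar K]) (pG : p.-nat #|{: gT}|).

(* The fixed vectors of a nonzero representation are nonzero and are killed by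
   the augmentation ideal, so the dimension drops in passing to the quotient. *)
Lemma galg_op_nil n (rG : mx_representation K GT n) m (W : 'M_(m, n)) s :
  (forall a, a \in s -> galg_aug a = 0) -> (n <= size s)%N ->
  foldl (fun W a => W *m galg_op rG a) W s = 0.
Proof.
have [k lenk] := ubnP n; elim: k n lenk rG m W s => // k IH n lenk rG m W s s0.
case: (posnP n) => [n0|n0]; first by subst n; move=> _; rewrite [LHS]thinmx0.
case/lastP: s s0 => [|s b] s0; first by rewrite leqNgt n0.
have pT : (p.-group GT)%g by rewrite /pgroup cardsT.
have U0 := rfix_pgroup_pchar pcharK rG n0 pT (subxx _).
pose U := rfix_mx rG GT; have Umod : mxmodule rG U := rfix_mx_module rG.
rewrite -cats1 foldl_cat size_cat /= addn1 => lens.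
set W' := foldl _ _ _; suff /rfix_mxP fixW : (W' <= U)%MS.
  rewrite /galg_op mulmx_sumr.
  under eq_bigr => g _ do rewrite -scalemxAr fixW ?inE//.
  rewrite -scaler_suml (_ : \sum_i b i = 0) ?scale0r//.
  by apply: s0; rewrite mem_rcons mem_head.
rewrite -in_factmod_eq0; apply/eqP.
have -> : in_factmod U W' =
    foldl (fun W a => W *m galg_op (factmod_repr Umod) a) (in_factmod U W) s.
  rewrite {}/W'; elim: s W {s0 lens} => //= a s IHs W; rewrite IHs.
  congr foldl; rewrite /galg_op !mulmx_sumr linear_sum; apply: eq_bigr => g _.
  by rewrite -!scalemxAr linearZ /= in_factmodJ ?inE.
have rk : (\rank (cokermx U) < n)%N.
  by rewrite mxrank_coker ltn_subrL n0 lt0n mxrank_eq0 U0.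
apply: IH; first exact: leq_trans rk lenk.
  by move=> a sa; apply: s0; rewrite mem_rcons in_cons sa orbT.
by rewrite -ltnS; exact: leq_trans rk lens.
Qed.

(** The regular representation has degree [gcard GT] and is faithful: the row of the identity in the
    matrix of an element lists its coefficients. *)
Lemma galg_aug_nilpotent : exists N, forall s : seq (galg K gT),
  (forall a, a \in s -> galg_aug a = 0) -> (N <= size s)%N ->
  \prod_(a <- s) a = 0.
Proof.
pose rG := regular_repr K GT; exists (gcard GT) => s s0 lens.
have := @galg_op_nil _ rG _ 1%:M s s0 lens.
rewrite -(galg_op1 rG) galg_op_prod mul1r.
move: (\prod_(_ <- _) _) => {s0 lens}s op0; apply/ffunP => g.
move/(congr1 (fun M : 'M_ _ => M (gring_index GT 1%g) (gring_index GT g))): op0.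
rewrite /galg_op [in RHS]mxE summxE (bigD1 g) //= !mxE gring_indexK ?inE// mul1g !eqxx mulr1 ffunE.
rewrite big1 ?addr0// => h /negbTE hg; rewrite !mxE gring_indexK ?inE// mul1g.
rewrite (can_in_eq (@gring_indexK _ GT%G)) ?inE//.
by rewrite eq_sym hg andbF mulr0.
Qed.

End GroupAlgebraOfPGroup.

(** * Homomorphisms from a free pro-p group to one-units *)

Definition discrete_group (gT : groupType) : Type := discrete_topology gT.

Section DiscreteGroup.
Variable gT : groupType.
HB.instance Definition _ := DiscreteTopology.on (discrete_group gT).
HB.instance Definition _ := monoid.Group.copy (discrete_group gT) gT.

Fact discrete_group_mul_continuous :
  continuous (fun xy : discrete_group gT * discrete_group gT => (xy.1 * xy.2)%g).
Proof.
case=> x y; apply/discrete_cvg; exists ([set x], [set y]) => /=.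
  by split; exact: discrete_set1.
by move=> [a b] /= [-> ->].
Qed.

Fact discrete_group_inv_continuous :
  continuous (fun x : discrete_group gT => (x^-1)%g).
Proof.
move=> x; apply/discrete_cvg.
suff : nbhs x ((fun y : discrete_group gT => (y^-1)%g) @^-1` [set (x^-1)%g]) by [].
by apply: open_nbhs_nbhs; split=> //; exact: discrete_open.
Qed.

HB.instance Definition _ := isTopologicalGroup.Build (discrete_group gT)
  discrete_group_mul_continuous discrete_group_inv_continuous.

Hypothesis gT_finite : finite_set [set: gT].

Definition finite_profinite : profiniteGroupType :=
  HB.pack (discrete_group gT)
    (isProfinite.Build (discrete_group gT)
       (@finite_compact (discrete_group gT) _ gT_finite)
       (@discrete_hausdorff (discrete_group gT))
       (zero_dimension_totally_disconnected (@discrete_zero_dimension (discrete_group gT)))).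

(** An exponent suffices: a finite group whose exponent is a power of [p] is a p-group, and
    exponents pass to quotients. *)
Lemma finite_profinite_pro_p p k : prime p ->
  (forall x : gT, (x ^+ (p ^ k) = 1)%g) -> pro_p p finite_profinite.
Proof.
move=> p_pr expg U; rewrite -cardsT.
have : (p.-nat (exponent [set: quo U]%SET))%g.
  apply: (@pnat_dvd _ (p ^ k)%N); last by rewrite pnatX pnat_id.
  apply/exponentP => c _; rewrite -(coset_reprK c).
  have projX n : coset_proj U (coset_repr c ^+ n)%g = (coset_proj U (coset_repr c) ^+ n)%g.
    by elim: n => // n IH; rewrite expgS coset_projM IH -expgS.
  by rewrite -projX (expg (coset_repr c)).
by rewrite pnat_exponent.
Qed.

End DiscreteGroup.

Lemma open_lcoset (F : topologicalGroupType) (U : set F) x :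
  open U -> open [set y | U (x^-1 * y)%g].
Proof.
move=> oU; apply: (@open_comp _ _ (fun y => (x^-1 * y)%g)) => // y _.
apply: (@cvg_comp _ _ _ (fun y => (x^-1%g, y)) (fun z => (z.1 * z.2)%g)
  (nbhs y) (nbhs (x^-1%g, y))); last exact: (mulg_continuous (x^-1%g, y)).
by apply: (@cvg_pair _ _ _ (nbhs y) (nbhs x^-1%g) (nbhs y));
  [exact: cvg_cst | exact: cvg_id].
Qed.

Section OneUnits.
Variables (p : nat) (R K : nzRingType) (chi : {rmorphism R -> K}).

(** What the truncated power series over ['F_p] and the group algebras of finite p-groups have in
    common; it makes the elements with [chi x = 1] a finite p-group. *)
Definition nil_augmentation :=
  [/\ p \in [pchar R], finite_set [set: R]
    & exists N, forall y, chi y = 0 -> y ^+ N = 0].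

Hypothesis R_nil : nil_augmentation.

(** Frobenius is additive on [1 + y], so [(1 + y) ^+ (p ^ k) = 1 + y ^+ (p ^ k)], and the last term
    vanishes once [p ^ k] exceeds the nilpotency bound. *)
Lemma one_unit_exp : exists k, forall x, chi x = 1 -> x ^+ (p ^ k) = 1.
Proof.
have [pcR _ [N nilN]] := R_nil.
have p_pr := pcharf_prime pcR.
exists N.+1 => // x x1; rewrite -(subrK 1 x).
have frob k (y : R) : (y + 1) ^+ (p ^ k) = y ^+ (p ^ k) + 1.
  elim: k => // k IH; rewrite expnSr !exprM IH.
  rewrite -(pFrobenius_autE pcR) pFrobenius_autD_comm ?pFrobenius_aut1//.
  exact: commr1.
have ltN : (N <= p ^ N.+1)%N.
  by rewrite ltnW // (ltn_trans (ltnSn N)) // ltn_expl ?prime_gt1.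
by rewrite frob -(subnK ltN) exprD nilN ?mulr0 ?add0r// rmorphB x1 rmorph1 subrr.
Qed.

(** Packages the one-units with the discrete topology, so that they can be a target in the universal
    property of [F]. *)
Lemma one_units_group : exists (H : profiniteGroupType) (i : H -> R),
  [/\ pro_p p H, (forall A : set H, open A), injective i,
      {morph i : x y / (x * y)%g >-> x * y}
    & forall x, chi x = 1 <-> exists h, i h = x].
Proof.
have [pcR finR _] := R_nil; have [k expR] := one_unit_exp.
pose T : choiceType := {x : R | chi x == 1}.
have valT (x : T) : chi (val x) = 1 by exact/eqP/(valP x).
have mulP (x y : T) : chi (val x * val y) == 1.
  by rewrite rmorphM !valT mulr1.
have invP (x : T) : chi (val x ^+ (p ^ k).-1) == 1.
  by rewrite rmorphXn valT expr1n.
have oneP : chi 1 == 1 by rewrite rmorph1.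
pose mul (x y : T) : T := Sub (val x * val y) (mulP x y).
(* Since [x ^+ (p ^ k) = 1], the inverse is a power of [x]. *)
pose inv (x : T) : T := Sub (val x ^+ (p ^ k).-1) (invP x).
pose one : T := exist _ 1 oneP.
have pk0 : (0 < p ^ k)%N by rewrite expn_gt0 prime_gt0// (pcharf_prime pcR).
have mulA : associative mul by move=> x y z; apply: val_inj; rewrite /= mulrA.
have mul1 : left_id one mul by move=> x; apply: val_inj; rewrite /= mul1r.
have mulr1 : right_id one mul by move=> x; apply: val_inj; rewrite /= mulr1.
have mulVr : left_inverse one inv mul.
  by move=> x; apply: val_inj; rewrite /= -exprSr prednK// expR//; exact: valT.
have mulrV : right_inverse one inv mul.
  by move=> x; apply: val_inj; rewrite /= -exprS prednK// expR//; exact: valT.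
pose gT : groupType := HB.pack (Choice.sort T) (isGroup.Build T mulA mul1 mulr1 mulVr mulrV).
have finT : finite_set [set: gT].
  apply: (@finite_preimage T R setT val) finR => x y _ _; exact: val_inj.
exists (finite_profinite finT), (fun x : gT => val x); split.
- apply: (@finite_profinite_pro_p _ _ _ k) => [|x]; first exact: pcharf_prime pcR.
  apply: val_inj; rewrite -[RHS](expR (val x)); last exact: valT.
  by elim: (p ^ k)%N => // n IH; rewrite expgS exprS -IH.
- exact: discrete_open.
- exact: val_inj.
- by [].
- move=> x; split=> [/eqP x1|[h <-]]; last exact: valT.
  by exists (Sub x x1 : T).
Qed.

Variables (d : nat) (F : profiniteGroupType) (sigma : 'I_d -> F).
Hypothesis F_free : free_pro_p p sigma.

(** Continuous homomorphisms into the group of one-units, expressed in [R] itself: continuity for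
    the discrete topology becomes triviality on an open normal subgroup. *)
Definition one_unit_hom (f : F -> R) :=
  [/\ {morph f : x y / (x * y)%g >-> x * y},
      exists U : openNormal F, forall x, U x -> f x = 1
    & forall x, chi (f x) = 1].

Lemma free_pro_p_lift (h : 'I_d -> R) : (forall j, chi (h j) = 1) ->
  exists2 f : F -> R, one_unit_hom f & forall j, f (sigma j) = h j.
Proof.
move=> h1; have [H [i [pH oH iI iM iP]]] := one_units_group.
have /choice[h' h'P] : forall j, exists y, i y = h j by move=> j; exact/iP.
have [f [fs _]] := F_free.2 H h' pH.
exists (i \o f); last by move=> j /=; rewrite fs.
have i1 : i 1%g = 1.
  have [y y1] : exists y, i y = 1 by apply/iP; rewrite rmorph1.
  by rewrite -[LHS]mul1r -{1}y1 -iM mulg1.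
split.
- by move=> x y /=; rewrite gmulfM iM.
- have tr : open [set 1%g : H] /\ normal_subgroup [set 1%g : H].
    split; first exact: oH.
    split; first by split=> // [x y -> ->|x ->]; rewrite /= ?mulg1 ?invg1.
    by move=> x y -> /=; rewrite conj1g.
  exists (openNormal_preimage f (OpenNormal tr)) => x /= fx.
  by rewrite [f x]fx.
- by move=> x; apply/iP; exists (f x).
Qed.

(** Both maps factor through continuous homomorphisms into the pro-p group of one-units, where the
    uniqueness half of the universal property applies. *)
Lemma free_pro_p_hom_unique (f g : F -> R) : one_unit_hom f -> one_unit_hom g ->
  (forall j, f (sigma j) = g (sigma j)) -> f = g.
Proof.
move=> fH gH fg; have [H [i [pH oH iI iM iP]]] := one_units_group.
have lift e : one_unit_hom e -> exists e' : {chom F -> H}, forall x, i (e' x) = e x.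
  move=> [eM [U Ue] e1].
  have /choice[e' e'P] : forall x, exists y, i y = e x by move=> x; exact/iP.
  have e'M : {morph e' : x y / (x * y)%g}.
    by move=> x y; apply: iI; rewrite iM !e'P eM.
  have e'1 : e' 1%g = 1%g by apply: (@mulgI _ (e' 1%g)); rewrite -e'M !mulg1.
  have e'C : continuous e'.
    move=> x A /nbhs_singleton Ax; rewrite /nbhs /=.
    have [oU [[U1 _ _] _]] := openNormalP U.
    apply: (@filterS _ (nbhs x) _ [set y | U (x^-1 * y)%g]).
      move=> y /= Uy; suff -> : e' y = e' x by [].
      apply: iI; rewrite -(mulVKg x y) e'M iM e'P (e'P (x^-1 * y)%g) (Ue _ Uy).
      by rewrite mulr1.
    by apply: open_nbhs_nbhs; split; [exact: open_lcoset | rewrite /= mulVg].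
  pose m : {chom F -> H} := HB.pack e' (isMultiplicative.Build F H e' e'M)
    (Multiplicative_isUMagmaMorphism.Build F H e' e'1)
    (isContinuous.Build F H e' e'C).
  by exists m.
have [f' f'P] := lift f fH; have [g' g'P] := lift g gH.
have [u [_ uU]] := F_free.2 H (f' \o sigma) pH.
apply/funext => x; rewrite -f'P -g'P (uU f') // (uU g') // => j.
by apply: iI; rewrite f'P g'P fg.
Qed.

End OneUnits.

(** * Power series and their evaluation *)

Section PowerSeries.
Variables (K : comNzRingType) (d : nat).
Implicit Types f g : ncps K d.

(** The left counterpart of [fox]: it strips the first letter, so that [f] is its constant term plus
    the sum of the [x_j * ncps_tail j f]. *)
Definition ncps_tail (j : 'I_d) f : ncps K d := fun w => f (j :: w).

Definition ncps_order_ge n f := forall w, (size w < n)%N -> f w = 0.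

Lemma ncps_mulE f g w :
  (f * g) w = \sum_(i < (size w).+1) f (take i w) * g (drop i w).
Proof. by []. Qed.

Lemma ncps_mul_eq n f f' g g' :
  (forall w, (size w <= n)%N -> f w = f' w) ->
  (forall w, (size w <= n)%N -> g w = g' w) ->
  forall w, (size w <= n)%N -> (f * g) w = (f' * g') w.
Proof.
move=> ff' gg' w wn; rewrite !ncps_mulE; apply: eq_bigr => i _.
rewrite ff' ?gg' // ?size_drop ?size_take_min.
  exact: leq_trans (leq_subr _ _) wn.
exact: leq_trans (geq_minr _ _) wn.
Qed.

Lemma ncps_mul_head f g : (f * g) [::] = f [::] * g [::].
Proof. exact: ncps_mul_nil. Qed.

Lemma ncps_order_geM m n f g :
  ncps_order_ge m f -> ncps_order_ge n g -> ncps_order_ge (m + n) (f * g).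
Proof.
move=> fm gn w wmn; rewrite ncps_mulE big1 // => i _.
have [im|mi] := ltnP i m; first by rewrite fm ?mul0r// size_take_min gtn_min im.
rewrite gn ?mulr0// size_drop ltn_subLR; last by rewrite -ltnS.
exact: leq_trans wmn (leq_add _ _).
Qed.

Lemma ncps_order_ge_le m n f : (m <= n)%N -> ncps_order_ge n f -> ncps_order_ge m f.
Proof. by move=> mn fn w wm; apply: fn; exact: leq_trans mn. Qed.

Lemma ncps_order_geD n f g :
  ncps_order_ge n f -> ncps_order_ge n g -> ncps_order_ge n (f + g).
Proof. by move=> fn gn w wn; rewrite ncps_addE fn ?gn ?addr0. Qed.

Lemma ncps_order_geZ n k f : ncps_order_ge n f -> ncps_order_ge n (k *: f).
Proof. by move=> fn w wn; rewrite -[LHS]/(k * f w) fn ?mulr0. Qed.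

Lemma ncps_order_geMl n f g : ncps_order_ge n g -> ncps_order_ge n (f * g).
Proof. by move=> gn; rewrite -(add0n n); exact: ncps_order_geM. Qed.

Lemma ncps_order_geMr n f g : ncps_order_ge n f -> ncps_order_ge n (f * g).
Proof. by move=> fn; rewrite -(addn0 n); exact: ncps_order_geM. Qed.

Lemma ncps_tailM j f g :
  ncps_tail j (f * g) = f [::] *: ncps_tail j g + ncps_tail j f * g.
Proof. by apply/funext => w; exact: ncps_mul_cons. Qed.

Lemma ncps_tail1 j : ncps_tail j 1 = 0.
Proof. by apply/funext => w. Qed.

Lemma ncps_tailX i j : ncps_tail i (ncpsX K j) = (i == j)%:R.
Proof.
apply/funext => w; rewrite /ncps_tail /ncpsX eqseq_cons.
by case: eqP.
Qed.

Lemma ncps_tailXM i j f : ncps_tail i (ncpsX K j * f) = (i == j)%:R * f.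
Proof. by rewrite ncps_tailM scale0r add0r ncps_tailX. Qed.

Section Evaluation.
Variables (A : algType K) (y : 'I_d -> A).

(** Horner's scheme on the first letter: [y j] is substituted for [x_j] in the words shorter than
    [n]. *)
Fixpoint ncps_eval n f : A :=
  if n is m.+1
  then (f [::])%:A + \sum_j y j * ncps_eval m (ncps_tail j f) else 0.

Lemma ncps_eval_ext n f g :
  (forall w, (size w < n)%N -> f w = g w) -> ncps_eval n f = ncps_eval n g.
Proof.
elim: n f g => //= n IH f g fg; congr (_ + _); first by rewrite fg.
by apply: eq_bigr => j _; rewrite (IH _ (ncps_tail j g)) // => w wn; exact: fg.
Qed.

Lemma ncps_eval_linear n : linear (ncps_eval n).
Proof.
elim: n => [|n IH] k f g /=; first by rewrite scaler0 addr0.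
rewrite scalerDr scaler_sumr addrACA; congr (_ + _).
  by rewrite [(_ + _) [::]]ncps_addE scalerDl scalerA.
rewrite -big_split; apply: eq_bigr => j _ /=.
by rewrite -[ncps_tail _ _]/(k *: ncps_tail j f + ncps_tail j g) IH mulrDr scalerAr.
Qed.

HB.instance Definition _ n :=
  GRing.isLinear.Build K (ncps K d) A *:%R (ncps_eval n) (ncps_eval_linear n).

Variable N : nat.
Hypothesis y_nil : forall w : seq 'I_d, (N <= size w)%N -> \prod_(j <- w) y j = 0.

(* A solution of the homogeneous recursion is a combination of products of
   arbitrarily many of the [y j]. *)
Lemma nilpotent_rec_eq0 (D : ncps K d -> A) :
  (forall f, D f = \sum_j y j * D (ncps_tail j f)) -> forall f, D f = 0.
Proof.
move=> Drec.
suff H n u f : (N <= size u + n)%N -> \prod_(j <- u) y j * D f = 0.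
  by move=> f; have := H N [::] f; rewrite big_nil mul1r; apply.
elim: n u f => [|n IH] u f; first by rewrite addn0 => /y_nil ->; rewrite mul0r.
move=> un; rewrite Drec mulr_sumr big1 // => j _.
have := IH (rcons u j) (ncps_tail j f); rewrite big_rcons mulrA size_rcons addSnnS.
exact.
Qed.

(** At the nilpotency bound the cutoff is invisible, so the same [N] appears on both sides of the
    recursion. *)
Lemma ncps_eval_rec f :
  ncps_eval N f = (f [::])%:A + \sum_j y j * ncps_eval N (ncps_tail j f).
Proof.
rewrite -[RHS]/(ncps_eval N.+1 f).
(* The prefix [u] records the factors already extracted: behind it the cutoffs [n] and [n.+1] agree
   as soon as [size u + n] reaches [N]. *)
suff H n u g : (N <= size u + n)%N ->
    \prod_(j <- u) y j * ncps_eval n g = \prod_(j <- u) y j * ncps_eval n.+1 g.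
  by have := H N [::] f; rewrite big_nil !mul1r; apply.
elim: n u g => [|n IH] u g; first by rewrite addn0 => /y_nil ->; rewrite !mul0r.
move=> un; rewrite [ncps_eval n.+1]lock /= -lock /= !mulrDr; congr (_ + _).
rewrite !mulr_sumr; apply: eq_bigr => j _; rewrite !mulrA.
by have := IH (rcons u j) (ncps_tail j g); rewrite big_rcons size_rcons addSnnS; apply.
Qed.

Lemma ncps_eval1 : ncps_eval N 1 = 1.
Proof.
rewrite ncps_eval_rec big1 => [|j _]; last by rewrite ncps_tail1 linear0 mulr0.
by rewrite addr0; exact: scale1r.
Qed.

(** In the variable [f], the difference of the two sides satisfies the homogeneous recursion, hence
    vanishes. *)
Lemma ncps_evalM f g : ncps_eval N (f * g) = ncps_eval N f * ncps_eval N g.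
Proof.
apply/eqP; rewrite -subr_eq0; apply/eqP.
move: f; apply: (@nilpotent_rec_eq0 (fun f => _ (f * g) - _ f * _ g)) => f /=.
have -> : ncps_eval N (f * g) = f [::] *: ncps_eval N g +
    \sum_j y j * ncps_eval N (ncps_tail j f * g).
  rewrite ncps_eval_rec.
  under eq_bigr do rewrite ncps_tailM linearD linearZ /= mulrDr -scalerAr.
  rewrite big_split /= -scaler_sumr addrA; congr (_ + _).
  by rewrite ncps_mul_head -scalerA -scalerDr -ncps_eval_rec.
have -> : ncps_eval N f * ncps_eval N g = f [::] *: ncps_eval N g +
    \sum_j y j * (ncps_eval N (ncps_tail j f) * ncps_eval N g).
  rewrite {1}(ncps_eval_rec f) mulrDl -scalerAl mul1r mulr_suml.
  by congr (_ + _); apply: eq_bigr => j _; rewrite mulrA.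
rewrite opprD addrACA subrr add0r -sumrB.
by apply: eq_bigr => j _; rewrite mulrBr.
Qed.

End Evaluation.
End PowerSeries.

(** * Truncated power series as finite rings *)

Section TruncatedPowerSeries.
Variables (K : comNzRingType) (d n : nat).

(** Series modulo order [n.+1]: the words of length at most [n] form a finite type, so this ring is
    finite over ['F_p]. *)
Definition tncps := {ffun n.-bseq 'I_d -> K^o}.
HB.instance Definition _ := GRing.Lmodule.copy tncps {ffun n.-bseq 'I_d -> K^o}.
Implicit Types (a b : tncps) (f g : ncps K d).

Definition tncps_val a : ncps K d := fun w => oapp a 0 (insub w).
Definition ncps_trunc f : tncps := [ffun w : n.-bseq 'I_d => f w].

Lemma tncps_valK a : ncps_trunc (tncps_val a) = a.
Proof. by apply/ffunP => w; rewrite ffunE /tncps_val valK. Qed.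

Lemma ncps_truncK f w : (size w <= n)%N -> tncps_val (ncps_trunc f) w = f w.
Proof. by move=> wn; rewrite /tncps_val insubT /= ffunE. Qed.

Lemma eq_ncps_trunc f g :
  (ncps_trunc f = ncps_trunc g) <-> (forall w, (size w <= n)%N -> f w = g w).
Proof.
split=> [fg w wn|fg]; first by rewrite -ncps_truncK// fg ncps_truncK.
by apply/ffunP => w; rewrite !ffunE fg// size_bseq.
Qed.

Definition tncps_mul a b := ncps_trunc (tncps_val a * tncps_val b).

Lemma ncps_truncM f g : ncps_trunc (f * g) = tncps_mul (ncps_trunc f) (ncps_trunc g).
Proof. by apply/eq_ncps_trunc; apply: ncps_mul_eq => w wn; rewrite ncps_truncK. Qed.

Lemma ncps_truncD f g : ncps_trunc (f + g) = ncps_trunc f + ncps_trunc g.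
Proof. by apply/ffunP => w; rewrite !ffunE. Qed.

Fact tncps_mulA : associative tncps_mul.
Proof.
move=> a b c; rewrite -(tncps_valK a) -(tncps_valK b) -(tncps_valK c).
by rewrite -!ncps_truncM mulrA.
Qed.
Fact tncps_mul1 : left_id (ncps_trunc 1) tncps_mul.
Proof. by move=> a; rewrite -(tncps_valK a) -ncps_truncM mul1r. Qed.
Fact tncps_mulr1 : right_id (ncps_trunc 1) tncps_mul.
Proof. by move=> a; rewrite -(tncps_valK a) -ncps_truncM mulr1. Qed.
Fact tncps_mulDl : left_distributive tncps_mul +%R.
Proof.
move=> a b c; rewrite -(tncps_valK a) -(tncps_valK b) -(tncps_valK c).
by rewrite -ncps_truncD -!ncps_truncM mulrDl ncps_truncD.
Qed.
Fact tncps_mulDr : right_distributive tncps_mul +%R.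
Proof.
move=> a b c; rewrite -(tncps_valK a) -(tncps_valK b) -(tncps_valK c).
by rewrite -ncps_truncD -!ncps_truncM mulrDr ncps_truncD.
Qed.
Fact tncps_1neq0 : ncps_trunc 1 != 0.
Proof.
by apply/eqP => /ffunP /(_ [bseq]); rewrite !ffunE => /eqP; rewrite oner_eq0.
Qed.

HB.instance Definition _ := GRing.Zmodule_isNzRing.Build tncps
  tncps_mulA tncps_mul1 tncps_mulr1 tncps_mulDl tncps_mulDr tncps_1neq0.

Lemma ncps_truncX f k : ncps_trunc (f ^+ k) = ncps_trunc f ^+ k.
Proof. by elim: k => // k IH; rewrite !exprS -IH; exact: ncps_truncM. Qed.

Definition tncps_head a : K := a [bseq].

Lemma tncps_head_trunc f : tncps_head (ncps_trunc f) = f [::].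
Proof. by rewrite /tncps_head ffunE. Qed.

Fact tncps_head_zmod : zmod_morphism tncps_head.
Proof. by move=> a b; rewrite /tncps_head !ffunE. Qed.
Fact tncps_head_monoid : monoid_morphism tncps_head.
Proof.
split=> [|a b]; first exact: tncps_head_trunc.
rewrite -(tncps_valK a) -(tncps_valK b) -[_ * _]ncps_truncM !tncps_head_trunc.
exact: ncps_mul_head.
Qed.
HB.instance Definition _ := GRing.isZmodMorphism.Build tncps K tncps_head tncps_head_zmod.
HB.instance Definition _ := GRing.isMonoidMorphism.Build tncps K tncps_head tncps_head_monoid.

End TruncatedPowerSeries.

Lemma tncps_nil_augmentation p d n : prime p ->
  nil_augmentation p (@tncps_head 'F_p d n).
Proof.
move=> p_pr; split.
- rewrite inE p_pr /=; apply/eqP/ffunP => w.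
  rewrite ffunMnE [RHS]ffunE. by rewrite -mulr_natr (pcharf0 (pchar_Fp p_pr)) mulr0.
- exact: (@finite_finset {ffun n.-bseq 'I_d -> 'F_p}).
- exists n.+1 => a; rewrite -(tncps_valK a) -ncps_truncX /= tncps_head_trunc.
  move: (tncps_val a) => f f0; rewrite -[RHS](tncps_valK 0).
  apply/eq_ncps_trunc => w wn; rewrite /tncps_val insubT /= ffunE.
  have f1 : ncps_order_ge 1 f by case.
  suff : ncps_order_ge n.+1 (f ^+ n.+1) by apply.
  by elim: (n.+1) => // k IH; rewrite exprS; exact: (ncps_order_geM (m := 1)).
Qed.

(** * The Magnus isomorphism *)

Section Augmentation.
Variables (K : comNzRingType) (gT : finGroupType).

Fact galg_aug_zmod : zmod_morphism (@galg_aug K gT).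
Proof. by move=> a b; rewrite /galg_aug -sumrB; apply: eq_bigr => g _; rewrite !ffunE. Qed.
Fact galg_aug_monoid : monoid_morphism (@galg_aug K gT).
Proof.
split=> [|a b].
  rewrite /galg_aug (bigD1 1%g) //= ffunE eqxx big1 ?addr0// => g /negbTE g1.
  by rewrite ffunE g1.
rewrite /galg_aug; under eq_bigr do rewrite galg_mulE.
rewrite exchange_big mulr_suml; apply: eq_bigr => h _ /=.
rewrite mulr_sumr (reindex_inj (mulgI h)) /=.
by apply: eq_bigr => g _; rewrite mulKg.
Qed.
HB.instance Definition _ :=
  GRing.isZmodMorphism.Build (galg K gT) K (@galg_aug K gT) galg_aug_zmod.
HB.instance Definition _ :=
  GRing.isMonoidMorphism.Build (galg K gT) K (@galg_aug K gT) galg_aug_monoid.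

Lemma galg_aug_of (g : gT) : galg_aug (galg_of K g) = 1.
Proof.
rewrite /galg_aug (bigD1 g) //= ffunE eqxx big1 ?addr0// => h /negbTE hg.
by rewrite ffunE hg.
Qed.

Lemma galg_augZ k (a : galg K gT) : galg_aug (k *: a) = k * galg_aug a.
Proof. by rewrite /galg_aug mulr_sumr; apply: eq_bigr => g _; rewrite ffunE. Qed.

End Augmentation.

Lemma galg_nil_augmentation p (gT : finGroupType) : prime p -> p.-nat #|{: gT}| ->
  nil_augmentation p (@galg_aug 'F_p gT).
Proof.
move=> p_pr pG; have pcF := pchar_Fp p_pr; split.
- rewrite inE p_pr /=; apply/eqP/ffunP => g.
  by rewrite ffunMnE [RHS]ffunE -mulr_natr (pcharf0 pcF) mulr0.
- exact: (@finite_finset {ffun gT -> 'F_p}).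
- have [N nilN] := galg_aug_nilpotent pcF pG; exists N => y y0.
  have -> : y ^+ N = \prod_(a <- nseq N y) a.
    by elim: (N) => [|n IH]; rewrite ?big_nil// exprS IH /= big_cons.
  by apply: nilN => [a /nseqP[-> _]|]; rewrite ?size_nseq.
Qed.

(** * Open normal subgroups and the levels of the completed group algebra *)

Section OpenNormalSubgroups.
Variable G : profiniteGroupType.

Lemma openNormalI_subproof (U V : openNormal G) :
  open (U `&` V) /\ normal_subgroup (U `&` V).
Proof.
have [oU [[U1 UM UV] UJ]] := openNormalP U.
have [oV [[V1 VM VV] VJ]] := openNormalP V.
split; first exact: openI.
split; first split=> // [x y [? ?] [? ?]|x [? ?]].
- by split; [exact: UM | exact: VM].
- by split; [exact: UV | exact: VV].
- by move=> x y [? ?]; split; [exact: UJ | exact: VJ].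
Qed.

Definition openNormalI (U V : openNormal G) := OpenNormal (openNormalI_subproof U V).

Lemma openNormal_inf (I : eqType) (s : seq I) (V : I -> openNormal G) :
  exists U : openNormal G, forall i, i \in s -> U `<=` V i.
Proof.
elim: s => [|i s [U sU]]; first by exists (openNormalT G).
exists (openNormalI U (V i)) => j; rewrite in_cons => /orP[/eqP ->|/sU sUj].
  exact: subIsetr.
by apply: subset_trans sUj; exact: subIsetl.
Qed.

Variable K : comNzRingType.
Implicit Types a b : cgalg K G.

Lemma cgalg_sumE (I : Type) (s : seq I) (P : pred I) (A : I -> cgalg K G) U :
  (\sum_(i <- s | P i) A i) U = \sum_(i <- s | P i) A i U.
Proof. by elim/big_rec2: _ => // i y f _ <-. Qed.

Lemma cgalg_ofM x y : cgalg_of K (x * y : G)%g = cgalg_of K x * cgalg_of K y.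
Proof.
apply: cgalg_eqP => U; rewrite -[RHS]/(_ U * _ U) /= -galg_ofM.
by rewrite coset_projM.
Qed.

Lemma cgalg_augE a U : cgalg_aug a = galg_aug (a U).
Proof.
rewrite /cgalg_aug -(cgalgP a (_ : U `<=` openNormalT G)) ?galg_aug_push//.
Qed.

(** This sum is the integral of the locally constant function [phi] against the measure [a]; it may
    be computed at any level fine enough for [phi]. *)
Lemma cgalg_push_sum (W : lmodType K) (phi : G -> W) a (U V : openNormal G) :
  V `<=` U -> (forall x y, U (x^-1 * y)%g -> phi x = phi y) ->
  \sum_(c : quo U) a U c *: phi (coset_repr c) =
  \sum_(c : quo V) a V c *: phi (coset_repr c).
Proof.
move=> sVU phiU; rewrite -(cgalgP a sVU).
rewrite [RHS](partition_big (@quo_map G G (idhom G) V U) xpredT) //=.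
apply: eq_bigr => c _; rewrite ffunE scaler_suml; apply: eq_bigr => c' /eqP <-.
by congr (_ *: _); apply/esym/phiU; exact: coset_reprP.
Qed.

End OpenNormalSubgroups.

(** * Substitution into power series and the Magnus expansion of group elements *)

Section Magnus.
Variables (p d : nat) (F : profiniteGroupType) (sigma : 'I_d -> F).
Hypothesis p_pr : prime p.
Hypothesis F_free : free_pro_p p sigma.
Let K := 'F_p.
Local Notation P := (ncps K d).

Definition sigma_at (U : openNormal F) j : galg K (quo U) :=
  galg_of K (coset_proj U (sigma j)) - 1.

Lemma sigma_at_nil U : exists N, forall w : seq 'I_d,
  (N <= size w)%N -> \prod_(j <- w) sigma_at U j = 0.
Proof.
have [N nilN] := galg_aug_nilpotent (pchar_Fp p_pr) (F_free.1 U).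
exists N => w Nw; rewrite -(big_map (sigma_at U) xpredT id) nilN ?size_map//.
by move=> a /mapP[j _ ->]; rewrite rmorphB rmorph1 /= galg_aug_of subrr.
Qed.

Definition sigma_index U := projT1 (cid (sigma_at_nil U)).
Definition sigma_eval U (f : P) := ncps_eval (sigma_at U) (sigma_index U) f.

Lemma sigma_indexP U (w : seq 'I_d) : (sigma_index U <= size w)%N ->
  \prod_(j <- w) sigma_at U j = 0.
Proof. by rewrite /sigma_index; case: cid => N /= nilN; exact: nilN. Qed.

Lemma sigma_eval_rec U f : sigma_eval U f =
  (f [::])%:A + \sum_j sigma_at U j * sigma_eval U (ncps_tail j f).
Proof. exact/ncps_eval_rec/sigma_indexP. Qed.

(** Both levels obey the same recursion because [sigma_at V j] is pushed to [sigma_at U j]; their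
    difference obeys the homogeneous one. *)
Lemma sigma_eval_coherent f : coherent (sigma_eval^~ f).
Proof.
move=> U V sVU; apply/eqP; rewrite -subr_eq0; apply/eqP; move: f.
apply: (nilpotent_rec_eq0 (sigma_indexP (U := U))) => f.
set push := galg_push _; have pushM := galg_pushM (K := K) (quo_id_morph sVU).
have push1 : push 1 = 1 by rewrite /push galg_push_of (quo_mapE (f := idhom F)).
have pushs j : push (sigma_at V j) = sigma_at U j.
  by rewrite /push raddfB /= galg_push_of (quo_mapE (f := idhom F)) //= -/push push1.
rewrite (sigma_eval_rec V) (sigma_eval_rec U) /push linearD linearZ linear_sum /=.
rewrite -/push push1 opprD addrACA subrr add0r -sumrB; apply: eq_bigr => j _.
by rewrite mulrBr -pushs -pushM.
Qed.

Definition ncps_cgalg (f : P) : cgalg K F := CGalg (sigma_eval_coherent f).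

Lemma ncps_cgalg_linear : linear ncps_cgalg.
Proof. by move=> k f g; apply: cgalg_eqP => U; exact: ncps_eval_linear. Qed.
HB.instance Definition _ :=
  GRing.isLinear.Build K P (cgalg K F) *:%R ncps_cgalg ncps_cgalg_linear.

Lemma ncps_cgalg_monoid : monoid_morphism ncps_cgalg.
Proof.
split=> [|f g]; apply: cgalg_eqP => U.
  exact/ncps_eval1/sigma_indexP.
exact/ncps_evalM/sigma_indexP.
Qed.
HB.instance Definition _ :=
  GRing.isMonoidMorphism.Build P (cgalg K F) ncps_cgalg ncps_cgalg_monoid.

Lemma ncps_cgalg_ext U : exists N, forall f g : P,
  (forall w, (size w < N)%N -> f w = g w) -> ncps_cgalg f U = ncps_cgalg g U.
Proof. by exists (sigma_index U) => f g; exact: ncps_eval_ext. Qed.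

Lemma ncps_cgalg_rec f : ncps_cgalg f =
  (f [::])%:A + \sum_j (cgalg_of K (sigma j) - 1) * ncps_cgalg (ncps_tail j f).
Proof.
apply: cgalg_eqP => U; rewrite [LHS]sigma_eval_rec.
by rewrite -[RHS]/(_ U + _ U) cgalg_sumE.
Qed.

Lemma cgalg_aug_ncps f U : galg_aug (ncps_cgalg f U) = f [::].
Proof.
rewrite [ncps_cgalg f U]sigma_eval_rec rmorphD rmorph_sum /= galg_augZ rmorph1 mulr1.
by rewrite big1 ?addr0// => j _; rewrite rmorphM rmorphB rmorph1 /= galg_aug_of subrr mul0r.
Qed.

Lemma ncps_cgalgX j : ncps_cgalg (ncpsX K j) = cgalg_of K (sigma j) - 1.
Proof.
rewrite ncps_cgalg_rec scale0r add0r (bigD1 j) //= big1 => [|i /negbTE ij].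
  by rewrite ncps_tailX eqxx rmorph1 mulr1 addr0.
by rewrite ncps_tailX ij rmorph0 mulr0.
Qed.

(** Applying [theta] to the recursion of [ncps_cgalg] gives the first-letter recursion of series,
    which determines the coefficients by induction on the word. *)
Lemma ncps_cgalgK (theta : cgalg K F -> P) : linear theta -> monoid_morphism theta ->
  (forall j, theta (cgalg_of _ (sigma j)) = 1 + ncpsX _ j) ->
  cancel ncps_cgalg theta.
Proof.
move=> tl [t1 tM] ts f; apply/funext => w.
pose tm : {linear cgalg K F -> P} :=
  HB.pack theta (GRing.isLinear.Build _ _ _ _ theta tl).
have trec g : theta (ncps_cgalg g) =
    (g [::])%:A + \sum_j ncpsX K j * theta (ncps_cgalg (ncps_tail j g)).
  rewrite ncps_cgalg_rec -[theta]/(tm : _ -> _) linearD linearZ linear_sum /= t1.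
  congr (_ + _); apply: eq_bigr => j _; rewrite tM; congr (_ * _).
  by rewrite -[theta]/(tm : _ -> _) linearB /= t1 ts addrC addKr.
elim: w f => [|i w IH] f; rewrite trec ncps_addE ncps_sumE.
  rewrite big1 ?addr0 => [|j _]; last by rewrite ncps_mul_head mul0r.
  exact: mulr1.
rewrite (_ : ((f [::])%:A : P) (i :: w) = 0) ?add0r; last exact: mulr0.
rewrite (bigD1 i) //= big1 ?addr0 => [|j /negbTE ji].
  by rewrite -[LHS]/(ncps_tail i _ w) ncps_tailXM eqxx mul1r IH.
by rewrite -[LHS]/(ncps_tail i _ w) ncps_tailXM eq_sym ji mul0r.
Qed.

(** Each truncation comes from the universal property; uniqueness makes the truncations compatible,
    so they glue coefficient by coefficient. *)
Lemma exists_magnus_series : exists mg : F -> P,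
  [/\ {morph mg : x y / (x * y)%g >-> x * y},
      (forall j, mg (sigma j) = 1 + ncpsX K j),
      (forall x, mg x [::] = 1)
    & forall n, exists U : openNormal F,
        forall x, U x -> forall w, (size w <= n)%N -> mg x w = (1 : P) w].
Proof.
have h1 n (j : 'I_d) : tncps_head (ncps_trunc n (1 + ncpsX K j)) = 1.
  by rewrite tncps_head_trunc ncps_addE addr0.
have fex : forall n, exists f : F -> tncps K d n,
    one_unit_hom (@tncps_head K d n) f /\
    forall j, f (sigma j) = ncps_trunc n (1 + ncpsX K j).
  move=> n; have [f ? ?] := free_pro_p_lift (tncps_nil_augmentation d n p_pr) F_free (h1 n).
  by exists f.
pose f n := projT1 (cid (fex n)); have fP n : one_unit_hom (@tncps_head K d n) (f n) /\
    forall j, f n (sigma j) = ncps_trunc n (1 + ncpsX K j).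
  exact: (projT2 (cid (fex n))).
clearbody f.
have compat m n x w : (n <= m)%N -> (size w <= n)%N ->
    tncps_val (f m x) w = tncps_val (f n x) w.
  move=> nm wn; have [[fM [U Uf] f1] fs] := fP m.
  (* Truncating the map of level [m] to level [n] again gives a one-unit homomorphism, with the same
     values on [sigma]. *)
  have fnE : (fun x => ncps_trunc n (tncps_val (f m x))) = f n.
    have [fnH fns] := fP n.
    apply: (free_pro_p_hom_unique (tncps_nil_augmentation d n p_pr) F_free) => //.
      split.
      - move=> x1 x2; rewrite fM -[RHS]ncps_truncM; apply/eq_ncps_trunc => u un.
        by rewrite ncps_truncK // (leq_trans un).
      - exists U => x1 /Uf ->; apply/eq_ncps_trunc => u un.
        by rewrite ncps_truncK // (leq_trans un).
      - move=> x1; rewrite /= tncps_head_trunc -[RHS](f1 x1) /=.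
        by rewrite -[in RHS](tncps_valK (f m x1)) tncps_head_trunc.
    move=> j; rewrite fs fns; apply/eq_ncps_trunc => u un.
    by rewrite ncps_truncK // (leq_trans un).
  by rewrite -fnE ncps_truncK.
pose mg x : P := fun w => tncps_val (f (size w) x) w.
have mgE n x w : (size w <= n)%N -> mg x w = tncps_val (f n x) w.
  by move=> wn; rewrite /mg -(@compat n).
exists mg; split.
- move=> x y; apply/funext => w; have [[fM _ _] _] := fP (size w).
  rewrite [LHS](mgE (size w))// fM -[_ * _]/(ncps_trunc _ _) ncps_truncK//.
  by apply: (@ncps_mul_eq _ _ (size w)) => // u uw; rewrite (mgE (size w)).
- by move=> j; apply/funext => w; rewrite /mg (fP _).2 ncps_truncK.
- move=> x; rewrite /mg; have [[_ _ f1] _] := fP 0%N.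
  by rewrite -[RHS](f1 x) /= -[in RHS](tncps_valK (f _ x)) tncps_head_trunc.
- move=> n; have [[_ [U Uf] _] _] := fP n; exists U => x Ux w wn.
  by rewrite (mgE n)// Uf// ncps_truncK.
Qed.

End Magnus.

(** * The Magnus isomorphism and its inverse *)

Section MagnusIsomorphism.
Variables (p d : nat) (F : profiniteGroupType) (sigma : 'I_d -> F).
Hypothesis p_pr : prime p.
Hypothesis F_free : free_pro_p p sigma.
Let K := 'F_p.
Local Notation P := (ncps K d).
Local Notation psi := (ncps_cgalg p_pr F_free).

Lemma exists_magnus_iso :
  exists2 theta : cgalg K F -> P, magnus_iso sigma theta & cancel theta psi.
Proof.
have [mg [mgM mgs mg0 mgU]] := exists_magnus_series p_pr F_free.
pose good n (V : openNormal F) :=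
  forall x, V x -> forall w, (size w <= n)%N -> mg x w = (1 : P) w.
have /choice[U UP] : forall n, exists U, good n U by [].
have good_coset n V x y w : good n V -> (size w <= n)%N -> V (x^-1 * y)%g ->
    mg x w = mg y w.
  move=> gV wn Vxy; rewrite -(mulVKg x y) mgM -[in LHS](mulr1 (mg x)).
  by apply: (ncps_mul_eq (n := n)) => // u un; rewrite gV.
(* The extension of [mg] by integration: the coefficient at [w] of [mg x] depends only on the coset
   of [x] modulo [U (size w)]. *)
pose theta (a : cgalg K F) : P :=
  fun w => \sum_(c : quo (U (size w))) a (U (size w)) c * mg (coset_repr c) w.
have thetaE n V a w : good n V -> (size w <= n)%N ->
    theta a w = \sum_(c : quo V) a V c * mg (coset_repr c) w.
  (* Two admissible levels are compared at their intersection. *)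
  move=> gV wn; pose W := openNormalI V (U (size w)).
  pose phi x : K^o := mg x w.
  rewrite -[LHS]/(\sum_c _ *: phi (coset_repr c)).
  rewrite -[RHS]/(\sum_c _ *: phi (coset_repr c)).
  rewrite (cgalg_push_sum a (_ : W `<=` U (size w))); last 2 first.
  - exact: subIsetr.
  - by move=> x y; apply: good_coset (leqnn _); exact: UP.
  rewrite -(cgalg_push_sum a (_ : W `<=` V)) //.
    exact: subIsetl.
  by move=> x y; apply: good_coset gV wn.
have theta_lin : linear theta.
  move=> k a b; apply/funext => w.
  rewrite -[RHS]/(k * theta a w + theta b w) /theta mulr_sumr -big_split /=.
  by apply: eq_bigr => c _; rewrite !ffunE mulrDl; congr (_ + _); exact/esym/mulrA.
have theta_of x : theta (cgalg_of K x) = mg x.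
  apply/funext => w; rewrite /theta (bigD1 (coset_proj _ x)) //= big1 ?addr0 => [|c].
    rewrite ffunE eqxx mul1r.
    by apply/esym; apply: good_coset (UP _) (leqnn _) _; exact: coset_reprP.
  by rewrite ffunE => /negbTE ->; rewrite mul0r.
have mg1 : mg 1%g = 1.
  apply/funext => w; apply: UP (leqnn _).
  by have [_ [[]]] := openNormalP (U (size w)).
have thetaM a b : theta (a * b) = theta a * theta b.
  apply/funext => w; pose V := U (size w); have gV : good (size w) V by exact: UP.
  rewrite ncps_mulE (thetaE (size w) V)//.
  under [RHS]eq_bigr => i _.
    rewrite (thetaE (size w) V) ?size_take_min ?geq_minr//.
    rewrite [X in _ * X](thetaE (size w) V) ?size_drop ?leq_subr//.
    rewrite big_distrlr /=; over.
  rewrite exchange_big /=.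
  under eq_bigr do rewrite galg_mulE mulr_suml.
  rewrite exchange_big /=; apply: eq_bigr => h _.
  rewrite [RHS]exchange_big (reindex_inj (mulgI h)) /=; apply: eq_bigr => k _.
  rewrite mulKg.
  have -> : mg (coset_repr (h * k)%g) w = (mg (coset_repr h) * mg (coset_repr k)) w.
    rewrite -mgM; apply: good_coset gV (leqnn _) _.
    by apply/coset_projP; rewrite coset_projM !coset_reprK.
  rewrite ncps_mulE mulr_sumr; apply: eq_bigr => i _.
  by rewrite !mulrA; congr (_ * _); rewrite -!mulrA; congr (_ * _); rewrite mulrC.
have theta_psi : cancel theta psi.
  (* Both sides are one-unit homomorphisms into the group algebra of [quo W] that agree on the
     generators. *)
  have psi_mg x W : psi (mg x) W = galg_of K (coset_proj W x).
    have nilW := galg_nil_augmentation p_pr (F_free.1 W).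
    have [N NP] := ncps_cgalg_ext p_pr F_free W.
    suff /(congr1 (@^~ x)) : (fun x => psi (mg x) W) =
        (fun x => galg_of K (coset_proj W x)) by [].
    apply: (free_pro_p_hom_unique nilW F_free).
    - split=> [x1 x2||x1]; first by rewrite mgM rmorphM.
        exists (U N) => x1 Ux1; rewrite (NP _ 1) ?rmorph1// => w wN.
        exact: (UP N x1 Ux1 w (ltnW wN)).
      by rewrite /= cgalg_aug_ncps mg0.
    - split=> [x1 x2||x1]; first by rewrite coset_projM galg_ofM.
        exists W => x1 Wx1; congr galg_of; apply/esym/coset_projP.
        by rewrite invg1 mul1g.
      by rewrite /= galg_aug_of.
    - move=> j; rewrite mgs (_ : psi _ = cgalg_of K (sigma j))//.
      by rewrite rmorphD rmorph1 /= ncps_cgalgX addrC subrK.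
  move=> a; apply: cgalg_eqP => W.
  have [N NP] := ncps_cgalg_ext p_pr F_free W.
  pose V := openNormalI W (U N); have sVW : V `<=` W by exact: subIsetl.
  have gV : good N V by move=> x [_ Ux]; exact: UP.
  (* At level [W] only words shorter than [N] matter, and on these [theta a] is a finite combination
     of expansions of group elements. *)
  rewrite (NP _ (\sum_(c : quo V) a V c *: mg (coset_repr c))); last first.
    move=> w wN; rewrite (thetaE N V)//; last exact: ltnW.
    by rewrite ncps_sumE.
  rewrite linear_sum cgalg_sumE -(cgalgP a sVW) [in RHS](galg_sum_of (a V)).
  rewrite linear_sum; apply: eq_bigr => c _.
  by rewrite !linearZ /= galg_push_of -[LHS]/(_ *: (psi _ W)) psi_mg.
have theta_s j : theta (cgalg_of K (sigma j)) = 1 + ncpsX K j by rewrite theta_of mgs.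
have theta1 : theta 1 = 1 by rewrite -[1]/(cgalg_of K 1%g) theta_of mg1.
exists theta => //; split=> //.
- exists psi => //; apply: ncps_cgalgK => //; split.
- move=> n; exists (U n) => a a0 w wn.
  rewrite (thetaE n (U n)) ?(ltnW wn)// big1 // => c _.
  by rewrite a0 ffunE mul0r.
Qed.

Lemma magnusP : magnus_iso sigma (magnus (p := p) sigma).
Proof.
have [theta tP _] := exists_magnus_iso.
by rewrite /magnus; case: xgetP => [t _ //|/(_ theta)].
Qed.

Lemma ncps_cgalg_magnusK : cancel psi (magnus sigma).
Proof. by have [_ lt mt _ st] := magnusP; exact: ncps_cgalgK. Qed.

Lemma magnus_ncps_cgalgK : cancel (magnus (p := p) sigma) psi.
Proof.
have [theta tP tK] := exists_magnus_iso.
by move=> a; rewrite -{1}(tK a) ncps_cgalg_magnusK tK.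
Qed.

(** Since [ncps_cgalg] produces a preimage of [f], the choice in [magnus_inv] never falls back on
    its default, and [ncps_cgalg] recovers the chosen preimage. *)
Lemma magnus_invE f : magnus_inv sigma f = psi f.
Proof.
rewrite /magnus_inv; case: xgetP => [a _ /= <-|/(_ (psi f))].
  by rewrite magnus_ncps_cgalgK.
by case; exact: ncps_cgalg_magnusK.
Qed.

End MagnusIsomorphism.

(** * The algebra of the presented group *)

Section Pushforward.
Variables (K : comNzRingType) (F G : profiniteGroupType) (phi : {chom F -> G}).
Local Notation push := (cgalg_push (K := K) phi).

Fact cgalg_push_linear : linear push.
Proof. by move=> k a b; apply: cgalg_eqP => U; exact: galg_push_linear. Qed.
HB.instance Definition _ :=
  GRing.isLinear.Build K (cgalg K F) (cgalg K G) *:%R push cgalg_push_linear.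

Lemma cgalg_push_of x : push (cgalg_of K x) = cgalg_of K (phi x).
Proof.
apply: cgalg_eqP => U /=; rewrite galg_push_of (quo_mapE (f := phi))//.
Qed.

Fact cgalg_push_monoid : monoid_morphism push.
Proof.
split=> [|a b].
  by rewrite -[1]/(cgalg_of K 1%g) cgalg_push_of gmulf1.
apply: cgalg_eqP => U; rewrite -[RHS]/(_ U * _ U) /=.
by apply: galg_pushM; apply: quo_mapM.
Qed.
HB.instance Definition _ :=
  GRing.isMonoidMorphism.Build (cgalg K F) (cgalg K G) push cgalg_push_monoid.

Lemma cgalg_push_at a (V : openNormal F) (U : openNormal G) :
  V `<=` phi @^-1` U -> push a U = galg_push (@quo_map F G phi V U) (a V).
Proof.
move=> sV; have sV' : V `<=` openNormal_preimage phi U by [].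
rewrite /= -(cgalgP a sV') galg_push_comp; congr (galg_push _ _).
apply/funext => c /=; rewrite -(coset_reprK c).
by rewrite (quo_mapE (f := idhom _))// !(quo_mapE (f := phi)).
Qed.

Lemma cgalg_aug_push a : cgalg_aug (push a) = cgalg_aug a.
Proof. by rewrite [LHS]galg_aug_push -cgalg_augE. Qed.

End Pushforward.

(** * Images of open normal subgroups under a surjection *)

Section OpenImage.
Variables (F G : profiniteGroupType) (phi : {chom F -> G}).

Lemma chomM x y : phi (x * y)%g = (phi x * phi y)%g. Proof. exact: gmulfM. Qed.
Lemma chom1 : phi 1%g = 1%g. Proof. exact: gmulf1. Qed.
Lemma chomV x : phi (x^-1)%g = (phi x)^-1%g.
Proof. by apply: (@mulgI _ (phi x)); rewrite -chomM !mulgV chom1. Qed.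

Lemma closed_lcoset (U : openNormal F) x : closed [set y | U (x^-1 * y)%g].
Proof.
have [oU [[U1 UM UV] _]] := openNormalP U.
rewrite -[X in closed X]setCK; apply: open_closedC; rewrite openE => y nUy.
apply: (@filterS _ (nbhs y) _ [set z | U (y^-1 * z)%g]); last first.
  by apply: open_nbhs_nbhs; split; [exact: open_lcoset | rewrite /= mulVg].
move=> z /= Uyz Uxz; apply: nUy => /=.
by have := UM _ _ Uxz (UV _ Uyz); rewrite invgM invgK -mulgA mulVKg.
Qed.

Hypothesis phi_surj : forall g, exists x, phi x = g.

(** For openness, the complement of the image is a finite union of images of cosets of [U]; these
    are compact, hence closed. *)
Lemma openNormal_image_subproof (U : openNormal F) :
  open (phi @` U) /\ normal_subgroup (phi @` U).
Proof.
have [oU [[U1 UM UV] UJ]] := openNormalP U; split; last first.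
  split; first split.
  - by exists 1%g => //; exact: chom1.
  - by move=> _ _ [x Ux <-] [y Uy <-]; exists (x * y)%g; [exact: UM | exact: chomM].
  - by move=> _ [x Ux <-]; exists (x^-1)%g; [exact: UV | exact: chomV].
  - move=> _ z [x Ux <-]; have [y <-] := phi_surj z; exists (x ^ y)%g; first exact: UJ.
    by rewrite !conjgE !chomM chomV.
pose B x := [set y | U (x^-1 * y)%g].
have cB x : closed (phi @` B x).
  apply: compact_closed; first exact: profinite_hausdorff.
  apply: continuous_compact; first by apply: continuous_subspaceT => y; exact: cts_fun.
  by apply: (subclosed_compact _ (@profinite_compact F)) => //; exact: closed_lcoset.
pose D := [set c : quo U | ~ (phi @` U) (phi (coset_repr c))].
have -> : phi @` U = ~` \bigcup_(c in D) (phi @` B (coset_repr c)).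
  apply/seteqP; split=> [_ [x Ux <-] [c Dc [y Uy yx]]|g].
    apply: Dc; exists (x * (((coset_repr c)^-1 * y))^-1)%g.
      by apply: UM => //; exact: UV.
    by rewrite chomM chomV chomM chomV invgM invgK yx mulKVg.
  have [x <-] := phi_surj g; move=> nB; apply: contrapT => nU; apply: nB.
  exists (coset_proj U x).
    move=> [u Uu ux]; apply: nU.
    exists (u * ((x^-1 * coset_repr (coset_proj U x)))^-1)%g.
      by apply: UM => //; apply: UV; exact: coset_reprP.
    by rewrite chomM chomV chomM chomV invgM invgK ux mulKVg.
  exists x => //; rewrite /B /=; apply/coset_projP; exact: coset_reprK.
by apply: closed_openC; apply: closed_bigcup => //; exact: finite_finset.
Qed.

Definition openNormal_image (U : openNormal F) := OpenNormal (openNormal_image_subproof U).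

End OpenImage.

(** * Fox derivatives and powers of the augmentation ideal *)

Section FoxCalculus.
Variables (K : comNzRingType) (d : nat).
Local Notation P := (ncps K d).
Implicit Types f g : P.

Lemma foxD j f g : fox j (f + g) = fox j f + fox j g.
Proof. by []. Qed.

Lemma fox_bigsum j (I : Type) (s : seq I) (A : I -> P) :
  fox j (\sum_(i <- s) A i) = \sum_(i <- s) fox j (A i).
Proof. by apply/funext => w; rewrite /fox !ncps_sumE. Qed.

Lemma fox_split f : f = ((f [::] : K)%:A : P) + \sum_j fox j f * ncpsX K j.
Proof.
apply/funext => w; rewrite ncps_addE ncps_sumE; case/lastP: w => [|w k].
  rewrite big1 ?addr0 => [|j _]; last exact: mul_ncpsX_nil.
  exact/esym/mulr1.
rewrite (_ : ((f [::] : K)%:A : P) (rcons w k) = 0) ?add0r; last first.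
  by rewrite -[LHS]/(_ * (rcons w k == [::])%:R); case: (w) => [|? ?]; rewrite mulr0.
rewrite (bigD1 k) //= mul_ncpsX_rcons eqxx mulr1 big1 ?addr0// => j /negbTE jk.
by rewrite mul_ncpsX_rcons eq_sym jk mulr0.
Qed.

Lemma fox_mul j f g : g [::] = 0 -> fox j (f * g) = f * fox j g.
Proof.
move=> g0; apply/esym; move: j; apply: fox_unique.
by rewrite [in LHS](fox_decomp g0) mulr_sumr; apply: eq_bigr => j _; rewrite mulrA.
Qed.

Lemma ncps_order_ge_fox n j f : ncps_order_ge n.+1 f -> ncps_order_ge n (fox j f).
Proof. by move=> fn w wn; apply: fn; rewrite size_rcons. Qed.

Lemma ncps_order_ge_fox1 n j f : ncps_order_ge n f -> ncps_order_ge (n - 1) (fox j f).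
Proof. by case: n => // n; rewrite subn1; exact: ncps_order_ge_fox. Qed.

Lemma ncpsX_order_ge (j : 'I_d) : ncps_order_ge 1 (ncpsX K j).
Proof. by case. Qed.

(** A series of order at least [n.+1] is the finite sum of its [fox j f * x_j], whose left factors
    have order at least [n]. The general [h] covers both the algebra of [F] and that of [G]. *)
Lemma ideal_pow_order (A : nzRingType) (h : {rmorphism P -> A}) (I : set A) n a :
  (forall a, exists f, h f = a) -> (forall f, I (h f) <-> f [::] = 0) ->
  ideal_pow I n a <-> exists2 f, ncps_order_ge n f & h f = a.
Proof.
move=> hs hI; elim: n a => [|n IH] a /=.
  by split=> // _; have [f <-] := hs a; exists f.
split=> [[s sI ->]|[f fn <-]].
  elim: s sI => [|[u v] s IHs] sI; first by exists 0; rewrite ?big_nil ?rmorph0.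
  have [f fn fE] : exists2 f, ncps_order_ge n.+1 f & h f = \sum_(ab <- s) ab.1 * ab.2.
    by apply: IHs => ab abs; apply: sI; rewrite in_cons abs orbT.
  have [/IH[g gn gE] /=] := sI (u, v) (mem_head _ _).
  have [e eE] := hs v; rewrite -eE => /hI e0.
  exists (g * e + f); last by rewrite big_cons rmorphD rmorphM fE gE eE.
  apply: ncps_order_geD fn; rewrite -(addn1 n); apply: ncps_order_geM => //.
  by case.
exists [seq (h (fox j f), h (ncpsX K j)) | j <- enum 'I_d].
  move=> _ /mapP[j _ ->] /=; split; last exact/hI.
  by apply/IH; exists (fox j f) => //; exact: ncps_order_ge_fox.
rewrite big_map big_enum /= {1}(fox_decomp (fn [::] isT)) rmorph_sum.
by apply: eq_bigr => j _; rewrite rmorphM.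
Qed.

End FoxCalculus.

(** * The surjection from power series onto the algebra of [G] *)

Section PresentedGroup.
Variables (p d : nat) (G F : profiniteGroupType).
Variables (sigma : 'I_d -> F) (phi : {chom F -> G}).
Hypotheses (p_pr : prime p) (F_free : free_pro_p p sigma).
Hypothesis phi_surj : forall g, exists x, phi x = g.
Let K := 'F_p.
Local Notation P := (ncps K d).
Local Notation psi := (ncps_cgalg p_pr F_free).
Local Notation theta := (magnus (p := p) sigma).

Definition presentation_map : P -> cgalg K G := cgalg_push phi \o psi.
HB.instance Definition _ := GRing.Linear.on presentation_map.
HB.instance Definition _ := GRing.RMorphism.on presentation_map.
Local Notation Pi := presentation_map.

Lemma presentation_map_ext U : exists N, forall f g : P,
  (forall w, (size w < N)%N -> f w = g w) -> Pi f U = Pi g U.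
Proof.
have [N NP] := ncps_cgalg_ext p_pr F_free (openNormal_preimage phi U).
exists N => f g /NP fg; exact: (congr1 (galg_push (@quo_map F G phi _ U)) fg).
Qed.

Lemma presentation_map_aug f : cgalg_aug (Pi f) = f [::].
Proof. by rewrite [LHS]cgalg_aug_push (cgalg_augE _ (openNormalT F)) cgalg_aug_ncps. Qed.

Lemma presentation_map_surj_at (b : cgalg K G) V : exists f, Pi f V = b V.
Proof.
have /choice[t tP] : forall c : quo V, exists x, phi x = coset_repr c.
  by move=> c; exact: phi_surj.
exists (theta (\sum_c b V c *: cgalg_of K (t c))).
rewrite -[Pi _]/(cgalg_push phi (psi _)) magnus_ncps_cgalgK linear_sum cgalg_sumE.
rewrite [RHS]galg_sum_of; apply: eq_bigr => c _; rewrite linearZ /=.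
by rewrite galg_push_of (quo_mapE (f := phi)) // tP coset_reprK.
Qed.

(* Compactness of the power series ring, in the form of Koenig's lemma: the
   truncations to words shorter than [n] form a finite set for every [n]. *)
Lemma presentation_map_surj (b : cgalg K G) : exists f, Pi f = b.
Proof.
pose C V f := Pi f V = b V.
have Cmono (U V : openNormal G) f : V `<=` U -> C V f -> C U f.
  by move=> sVU Cf; rewrite /C -(cgalgP (Pi f) sVU) -(cgalgP b sVU) Cf.
pose agree n (f g : P) := forall w, (size w < n)%N -> f w = g w.
(* The part of [t] on words shorter than [n] extends, at every level [V], to a solution at that
   level. *)
pose good n t := forall V, exists2 f, C V f & agree n f t.
have /choice[next nextP] : forall nt : nat * P, exists t',
    good nt.1 nt.2 -> good nt.1.+1 t' /\ agree nt.1 t' nt.2.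
  move=> [n t] /=; apply: contrapT => /forallNP no.
  have gt : good n t by apply: contrapT => ngt; apply: (no 0).
  (* If no prolongation is good, each of the finitely many candidates [s] fails at some level [V s];
     a level below all of these then contradicts that [t] is good. *)
  have /choice[V VP] : forall s : {ffun n.-bseq 'I_d -> 'F_p}, exists V : openNormal G,
      forall f, C V f -> agree n f t -> ncps_trunc n f <> s.
    move=> s; apply: contrapT => /forallNP nV; apply: (no (tncps_val (s : tncps K d n))).
    have agree_s f : ncps_trunc n f = s -> agree n.+1 f (tncps_val (s : tncps K d n)).
      by move=> <- w wn; rewrite ncps_truncK.
    have nV' W : exists f, [/\ C W f, agree n f t & ncps_trunc n f = s].
      apply: contrapT => nf; apply: (nV W) => f Cf af fs; apply: nf.
      by exists f.
    move=> _; split=> [W|w wn].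
      by have [f [Cf _ /agree_s fs]] := nV' W; exists f.
    have [f [Cf af fs]] := nV' (openNormalT G).
    by rewrite -(af _ wn) (agree_s _ fs)//; exact: ltnW.
  have [W WV] := openNormal_inf (enum {ffun n.-bseq 'I_d -> 'F_p}) V.
  have [f Cf af] := gt W.
  have sW := WV (ncps_trunc n f) (mem_enum _ _).
  exact: (VP (ncps_trunc n f) f (Cmono _ _ _ sW Cf) af).
pose t := fix t n : P := if n is m.+1 then next (m, t m) else 0.
have good_t n : good n (t n).
  elim: n => [V|n IH]; last exact: (nextP (n, t n) IH).1.
  by have [f fV] := presentation_map_surj_at b V; exists f.
have agree_t n m : (n <= m)%N -> agree n (t m) (t n).
  move=> /subnK <-; elim: (m - n)%N => // k IH w wn; rewrite addSn.
  rewrite -(IH w wn); apply: (nextP (k + n, t (k + n)) (good_t _)).2.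
  exact: leq_trans wn (leq_addl _ _).
(* The stage [t n] is settled only on words shorter than [n], hence the index [(size w).+1]. *)
pose f : P := fun w => t (size w).+1 w; exists f; apply: cgalg_eqP => V.
have [N NP] := presentation_map_ext V; have [g Cg ag] := good_t N V.
by rewrite -Cg; apply: NP => w wN; rewrite ag// /f -(agree_t _ _ wN).
Qed.

Lemma ideal_pow_presentation n a : ideal_pow (@aug_ideal K G) n a <->
  exists2 f, ncps_order_ge n f & Pi f = a.
Proof.
apply: ideal_pow_order; first exact: presentation_map_surj.
by move=> f; rewrite /aug_ideal /= presentation_map_aug.
Qed.

Lemma ideal_pow_magnus n a : ideal_pow (@aug_ideal K F) n a ->
  ncps_order_ge n (theta a).
Proof.
case/(ideal_pow_order (h := psi)) => [{}a|f|f fn <-].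
- by exists (theta a); exact: magnus_ncps_cgalgK.
- by rewrite /aug_ideal /= (cgalg_augE _ (openNormalT F)) cgalg_aug_ncps.
- by rewrite ncps_cgalg_magnusK.
Qed.

Lemma presentation_map_magnus a : Pi (theta a) = cgalg_push phi a.
Proof. by rewrite -[LHS]/(cgalg_push phi (psi _)) magnus_ncps_cgalgK. Qed.

End PresentedGroup.

(** * The kernel of the presentation *)

Section Relations.
Variables (p d r : nat) (G F : profiniteGroupType).
Variables (sigma : 'I_d -> F) (phi : {chom F -> G}) (rho : 'I_r -> F).
Hypotheses (p_pr : prime p) (F_free : free_pro_p p sigma).
Hypothesis phi_surj : forall g, exists x, phi x = g.
Hypothesis phi_rho : forall i, phi (rho i) = 1%g.
Hypothesis rho_gen : smallest (@closed_normal_subgroup F) (range rho) = ker phi.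
Let K := 'F_p.
Local Notation P := (ncps K d).
Local Notation theta := (magnus (p := p) sigma).
Local Notation Pi := (presentation_map phi p_pr F_free).

Definition rel_series i : P := theta (cgalg_of K (rho i) - 1).

Lemma presentation_map_rel i : Pi (rel_series i) = 0.
Proof.
rewrite presentation_map_magnus linearB /= cgalg_push_of phi_rho.
by rewrite rmorph1 subrr.
Qed.

(* This left ideal is two-sided: writing a right factor as a constant plus a
   combination of the [x_j] moves it into the second sum. *)
Definition rel_ideal n : set P := [set f | exists (b : 'I_r -> P) (k : 'I_d -> P),
  (forall j, Pi (k j) = 0) /\
  ncps_order_ge n (f - (\sum_i b i * rel_series i + \sum_j k j * ncpsX K j))].

Lemma rel_idealD n f g : rel_ideal n f -> rel_ideal n g -> rel_ideal n (f + g).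
Proof.
move=> [b [k [k0 fn]]] [b' [k' [k'0 gn]]].
exists (fun i => b i + b' i), (fun j => k j + k' j); split.
  by move=> j; rewrite rmorphD /= k0 k'0 addr0.
have := ncps_order_geD fn gn; congr ncps_order_ge.
under [X in _ = _ - (X + _)]eq_bigr do rewrite mulrDl.
under [X in _ = _ - (_ + X)]eq_bigr do rewrite mulrDl.
by rewrite !big_split /= [X in _ = _ - X]addrACA [X in _ = _ + X]opprD [RHS]addrACA.
Qed.

Lemma rel_ideal_mull n g f : rel_ideal n f -> rel_ideal n (g * f).
Proof.
move=> [b [k [k0 fn]]]; exists (fun i => g * b i), (fun j => g * k j); split.
  by move=> j; rewrite rmorphM /= k0 mulr0.
have := ncps_order_geMl g fn; congr ncps_order_ge.
rewrite mulrBr mulrDr !mulr_sumr; congr (_ - (_ + _)).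
  by apply: eq_bigr => i _; rewrite mulrA.
by apply: eq_bigr => j _; rewrite mulrA.
Qed.

Lemma rel_ideal_order n f : ncps_order_ge n f -> rel_ideal n f.
Proof.
move=> fn; exists (fun=> 0), (fun=> 0); split; first by move=> j; rewrite rmorph0.
by rewrite !big1 => [|j _|i _]; rewrite ?mul0r// addr0 subr0.
Qed.

Lemma rel_idealZ n k f : rel_ideal n f -> rel_ideal n (k *: f).
Proof. by rewrite -[f]mul1r scalerAl mul1r; exact: rel_ideal_mull. Qed.

Lemma rel_idealN n f : rel_ideal n f -> rel_ideal n (- f).
Proof. by rewrite -scaleN1r; exact: rel_idealZ. Qed.

Lemma rel_ideal_sum n (I : Type) (s : seq I) (Q : pred I) (A : I -> P) :
  (forall i, Q i -> rel_ideal n (A i)) -> rel_ideal n (\sum_(i <- s | Q i) A i).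
Proof.
move=> An; elim/big_rec: _ => [|i x /An]; last exact: rel_idealD.
exact: rel_ideal_order.
Qed.

Lemma rel_ideal_rel n i : rel_ideal n (rel_series i).
Proof.
exists (fun j => (j == i)%:R), (fun=> 0); split; first by move=> j; rewrite rmorph0.
rewrite (bigD1 i) //= eqxx mul1r !big1 => [|j _|j /negbTE ->]; rewrite ?mul0r//.
by rewrite !addr0 subrr.
Qed.

Lemma rel_ideal_kerX n k j : Pi k = 0 -> rel_ideal n (k * ncpsX K j).
Proof.
move=> k0; exists (fun=> 0), (fun i => if i == j then k else 0); split.
  by move=> i; case: ifP; rewrite ?rmorph0.
rewrite (bigD1 j) //= eqxx !big1 => [|i /negbTE ->|i _]; rewrite ?mul0r//.
by rewrite addr0 add0r subrr.
Qed.

Lemma rel_ideal_mulr n f g : rel_ideal n f -> rel_ideal n (f * g).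
Proof.
move=> fI; rewrite (fox_split g) mulrDr -scalerAr mulr1 mulr_sumr.
apply: rel_idealD; first exact: rel_idealZ.
apply: rel_ideal_sum => j _; have [b [k [k0 fn]]] := fI; rewrite mulrA.
rewrite -(subrK (\sum_i b i * rel_series i + \sum_j k j * ncpsX K j) f).
rewrite (mulrDl _ _ (fox j g)) mulrDl; apply: rel_idealD.
  by apply/rel_ideal_order/ncps_order_geMr/ncps_order_geMr.
(* The combination approximating [f] is killed by [Pi]; multiplied by [fox j g] it is therefore an
   admissible coefficient of [x_j]. *)
apply: rel_ideal_kerX; rewrite rmorphM rmorphD !rmorph_sum !big1 ?addr0 ?mul0r// => i _.
  by rewrite rmorphM /= k0 mul0r.
by rewrite rmorphM /= presentation_map_rel mulr0.
Qed.

Let magnusM a b : theta (a * b) = theta a * theta b.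
Proof. by have [_ _ [_ tM] _ _] := magnusP p_pr F_free; exact: tM. Qed.

Let magnus1 : theta 1 = 1.
Proof. by have [_ _ [t1 _] _ _] := magnusP p_pr F_free; exact: t1. Qed.

Let magnus_linear : linear theta.
Proof. by have [_ tl _ _ _] := magnusP p_pr F_free; exact: tl. Qed.

HB.instance Definition _ :=
  GRing.isLinear.Build K (cgalg K F) P *:%R theta magnus_linear.

(** The group elements congruent to 1 modulo [rel_ideal n]. It serves to catch all of [ker phi],
    which is the smallest closed normal subgroup containing the [rho i]. *)
Definition rel_subgroup n : set F :=
  [set x | rel_ideal n (theta (cgalg_of K x) - 1)].

Lemma magnus_open n : exists U : openNormal F,
  (forall a : cgalg K F, a U = 0 -> ncps_order_ge n (theta a)) /\
  (forall x, U x -> rel_subgroup n x).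
Proof.
have [_ _ _ /(_ n)[U UP] _] := magnusP p_pr F_free.
exists U; split=> [a /UP//|x Ux].
apply: rel_ideal_order; rewrite -magnus1 -linearB; apply: UP.
rewrite -[LHS]/(galg_of K (coset_proj U x) - 1) (_ : coset_proj U x = 1%g) ?subrr//.
by apply/esym/coset_projP; rewrite invg1 mul1g.
Qed.

(** Normality rests on the ideal being two-sided, and closedness on the subgroup containing an open
    one. *)
Lemma rel_subgroupP n : closed_normal_subgroup (rel_subgroup n).
Proof.
have S1 : rel_subgroup n 1%g.
  by rewrite /rel_subgroup /= magnus1 subrr; exact: rel_ideal_order.
have SM x y : rel_subgroup n x -> rel_subgroup n y -> rel_subgroup n (x * y)%g.
  rewrite /rel_subgroup /= cgalg_ofM magnusM => Sx Sy.
  rewrite -(subrK (theta (cgalg_of K y)) (_ * _)) -{2}(mul1r (theta (cgalg_of K y))).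
  rewrite -mulrBl -addrA; apply: rel_idealD => //; exact: rel_ideal_mulr.
have thV x : theta (cgalg_of K (x^-1)%g) * theta (cgalg_of K x) = 1.
  by rewrite -magnusM -cgalg_ofM mulVg; exact: magnus1.
have SV x : rel_subgroup n x -> rel_subgroup n (x^-1)%g.
  rewrite /rel_subgroup /= => /(rel_ideal_mull (theta (cgalg_of K (x^-1)%g))) /rel_idealN.
  by rewrite mulrBr thV mulr1 opprB.
have SJ x y : rel_subgroup n x -> rel_subgroup n (x ^ y)%g.
  rewrite /rel_subgroup /= conjgE !cgalg_ofM !magnusM => Sx.
  rewrite -(thV y) -{2}(mul1r (theta (cgalg_of K y))) -mulrBr -mulrBl.
  by apply: rel_ideal_mull; exact: rel_ideal_mulr.
split=> //; have [U [_ US]] := magnus_open n.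
have [oU [[U1 UM UV] _]] := openNormalP U.
rewrite -[X in closed X]setCK; apply: open_closedC; rewrite openE => y nSy.
apply: (@filterS _ (nbhs y) _ [set z | U (y^-1 * z)%g]); last first.
  by apply: open_nbhs_nbhs; split; [exact: open_lcoset | rewrite /= mulVg].
move=> z /= /US Syz Sz; apply: nSy => /=.
by have := SM _ _ Sz (SV _ Syz); rewrite invgM invgK mulVKg.
Qed.

Lemma ker_presentation_map n f : Pi f = 0 -> rel_ideal n f.
Proof.
move=> f0; have [U [UP US]] := magnus_open n.
have [_ [[S1 SM SV] SJ]] := rel_subgroupP n.
have kerS x : phi x = 1%g -> rel_subgroup n x.
  suff : ker phi `<=` rel_subgroup n by apply.
  rewrite -rho_gen; apply: smallest_sub; first exact: rel_subgroupP.
  move=> _ [i _ <-]; have := rel_ideal_rel n i.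
  by rewrite /rel_series linearB /= magnus1.
(* With [W] the exact image of [U], elements of [F] congruent modulo [W] differ by an element of
   [ker phi] times one of [U]. *)
pose W := openNormal_image phi_surj U.
have sUW : U `<=` phi @^-1` W by move=> x Ux; exists x.
pose a := ncps_cgalg p_pr F_free f.
have aW0 : galg_push (@quo_map F G phi U W) (a U) = 0.
  by rewrite -(cgalg_push_at a sUW) -[cgalg_push phi a]/(Pi f) f0.
pose a' := \sum_(c : quo U) a U c *: cgalg_of K (coset_repr c).
have aa' : (a - a') U = 0.
  rewrite -[LHS]/(a U - a' U) /a' cgalg_sumE {1}(galg_sum_of (a U)).
  apply/eqP; rewrite subr_eq0; apply/eqP; apply: eq_bigr => c _.
  by rewrite -[RHS]/(_ *: galg_of K (coset_proj U (coset_repr c))) coset_reprK.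
have -> : f = theta (a - a') + theta a'.
  by rewrite -linearD subrK; exact/esym/ncps_cgalg_magnusK.
apply: rel_idealD; first exact/rel_ideal_order/UP.
have /choice[t tP] : forall y : quo W, exists x, coset_proj W (phi x) = y.
  by move=> y; have [x xE] := phi_surj (coset_repr y); exists x; rewrite xE coset_reprK.
pose M x := theta (cgalg_of K x).
(* Subtracting one fixed representative per fibre of [quo_map] changes nothing, because the
   coefficients in each fibre sum to zero. *)
have -> : theta a' = \sum_(c : quo U)
    a U c *: (M (coset_repr c) - M (t (quo_map phi W c))).
  under [RHS]eq_bigr do rewrite scalerBr.
  rewrite sumrB /a' linear_sum /= [X in _ = _ - X](_ : _ = 0) ?subr0.
    by apply: eq_bigr => c _; rewrite linearZ.
  rewrite (partition_big (quo_map phi W) xpredT) //= big1 // => y _.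
  under eq_bigr => c /eqP -> do [].
  rewrite -scaler_suml; move/ffunP: aW0 => /(_ y).
  by rewrite !ffunE => ->; rewrite scale0r.
apply: rel_ideal_sum => c _; apply: rel_idealZ.
set x := coset_repr c; set x' := t _.
have [u Uu uE] : W ((phi x')^-1 * phi x)%g by apply/coset_projP; rewrite tP.
(* Now [x = x' * k * u] with [k] in [ker phi] and [u] in [U], both inside [rel_subgroup n]. *)
pose k := (x'^-1 * x * u^-1)%g.
have Sk : rel_subgroup n (k * u)%g.
  apply: SM; last exact: US.
  by apply: kerS; rewrite /k !chomM !chomV uE invgM invgK -!mulgA mulVKg mulVg.
have -> : x = (x' * (k * u))%g by rewrite /k mulgKV mulVKg.
rewrite /M cgalg_ofM magnusM -[X in _ - X]mulr1 -mulrBr.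
exact: rel_ideal_mull.
Qed.

End Relations.

(** * The exact sequence *)

Section AugmentationPowers.
Variables (p d : nat) (G F : profiniteGroupType).
Variables (sigma : 'I_d -> F) (phi : {chom F -> G}).
Hypotheses (p_pr : prime p) (F_free : free_pro_p p sigma).
Hypothesis phi_surj : forall g, exists x, phi x = g.
Let K := 'F_p.
Local Notation A := (cgalg K G).
Local Notation Pi := (presentation_map phi p_pr F_free).
Local Notation Ip := (ideal_pow (@aug_ideal K G)).
Let IpP n (a : A) := ideal_pow_presentation p_pr F_free phi_surj n a.

Lemma aug_pow_subspace n : subspace (Ip n).
Proof.
split=> [|k a b /IpP[f fn <-] /IpP[g gn <-]]; apply/IpP.
  by exists 0; rewrite ?rmorph0.
exists (k *: f + g); last by rewrite linearP.
by apply: ncps_order_geD => //; exact: ncps_order_geZ.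
Qed.

Lemma aug_powM m n a b : Ip m a -> Ip n b -> Ip (m + n) (a * b).
Proof.
move=> /IpP[f fm <-] /IpP[g gn <-]; apply/IpP; exists (f * g); last exact: rmorphM.
exact: ncps_order_geM.
Qed.

Lemma aug_pow_le m n : (m <= n)%N -> Ip n `<=` Ip m.
Proof.
by move=> mn a /IpP[f fn <-]; apply/IpP; exists f => //; exact: ncps_order_ge_le fn.
Qed.

Lemma aug_pow1 a : Ip 1 a <-> cgalg_aug a = 0.
Proof.
split=> [/IpP[f f1 <-]|]; first by rewrite presentation_map_aug f1.
have [f <-] := presentation_map_surj p_pr F_free phi_surj a.
rewrite presentation_map_aug => f0; apply/IpP; exists f => //.
by case.
Qed.

(** Images of the monomials of length at most [n] span modulo [I^n]. Finiteness has to be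
    established because [quot_dim] defaults to zero. *)
Lemma aug_quot_dimP n : quot_dim_is setT (Ip n) (aug_quot_dim p G n).
Proof.
apply: quot_dim_isP; pose T := n.-bseq 'I_d.
pose mono (w : seq 'I_d) : ncps K d := fun u => (u == w)%:R.
pose e (i : 'I_#|{: T}|) : T := enum_val i.
apply: (@quot_dim_is_spanned_exists _ _ _ _ #|{: T}| (aug_pow_subspace n)).
exists (fun i => Pi (mono (e i))) => a _.
have [f <-] := presentation_map_surj p_pr F_free phi_surj a.
exists (fun i => f (e i)); apply/IpP.
exists (f - \sum_i f (e i) *: mono (e i)); last first.
  rewrite linearB linear_sum /=; congr (_ - _); apply: eq_bigr => i _.
  by rewrite linearZ.
move=> u un; rewrite -[LHS]/(f u - _ u) ncps_sumE.
pose b : T := Bseq (ltnW un : (size u <= n)%N).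
rewrite (bigD1 (enum_rank b)) //= big1 ?addr0 => [|i ni].
  rewrite /e enum_rankK /=.
  by rewrite -[X in _ - X]/(_ * (u == u)%:R) eqxx mulr1 subrr.
rewrite -[LHS]/(_ * (u == _)%:R); case: eqP => [uE|]; last by rewrite mulr0.
case/negP: ni; rewrite -(inj_eq enum_val_inj) enum_rankK -val_eqE /=.
by rewrite -/(e i) -uE.
Qed.

Lemma aug_quot_dim0 : aug_quot_dim p G 0 = 0%N.
Proof. by apply: quot_dim_is_xget (aug_pow_subspace 0) _; exact: quot_dim_is_refl. Qed.

Lemma aug_quot_dim1 : quot_dim_is setT (Ip 1) 1.
Proof.
have aug1 : cgalg_aug (1 : A) = 1 by rewrite (cgalg_augE _ (openNormalT G)) galg_aug_of.
have augZ k (a : A) : cgalg_aug (k *: a) = k * cgalg_aug a by exact: galg_augZ.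
have augB (a b : A) : cgalg_aug (a - b) = cgalg_aug a - cgalg_aug b by exact: raddfB.
exists (fun=> 1); split=> // [u _|c]; rewrite ?big_ord1.
  exists (fun=> cgalg_aug u); rewrite big_ord1; apply/aug_pow1.
  by rewrite augB augZ aug1 mulr1 subrr.
by move=> /aug_pow1; rewrite augZ aug1 mulr1 => c0 i; rewrite (ord1 i).
Qed.

End AugmentationPowers.

(** * The Jacobian sequence and the dimension count *)

Section ExactSequence.
Variables (p d r : nat) (G F : profiniteGroupType).
Variables (sigma : 'I_d -> F) (phi : {chom F -> G}) (rho : 'I_r -> F).
Variable v : 'I_r -> nat.
Hypotheses (p_pr : prime p) (F_free : free_pro_p p sigma).
Hypothesis phi_surj : forall g, exists x, phi x = g.
Hypothesis phi_rho : forall i, phi (rho i) = 1%g.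
Hypothesis rho_gen : smallest (@closed_normal_subgroup F) (range rho) = ker phi.
Hypothesis rho_level : forall i, level_is 'F_p (rho i) (v i).
Let K := 'F_p.
Local Notation A := (cgalg K G).
Local Notation Pi := (presentation_map phi p_pr F_free).
Local Notation Ip := (ideal_pow (@aug_ideal K G)).
Local Notation c := (aug_quot_dim p G).
Local Notation f_ := (rel_series p sigma rho).
Local Notation J := (jacobian_map sigma phi rho).
Let IpP n (a : A) := ideal_pow_presentation p_pr F_free phi_surj n a.

Lemma rel_level_gt0 i : (0 < v i)%N.
Proof.
apply: (rho_level i).2; exists [:: (1, cgalg_of K (rho i) - 1)].
  move=> _ /[!inE] /eqP -> /=; split=> //; rewrite /aug_ideal /=.
  by rewrite /cgalg_aug raddfB /= rmorph1 galg_aug_of subrr.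
by rewrite big_seq1 mul1r.
Qed.

Lemma rel_series_order i : ncps_order_ge (v i) (f_ i).
Proof. by apply: ideal_pow_magnus p_pr F_free _ _ _; exact: (rho_level i).1. Qed.

Lemma rel_series_head i : f_ i [::] = 0.
Proof. by apply: rel_series_order; exact: rel_level_gt0. Qed.

Lemma jacobianE i j : jacobian p sigma phi rho i j = Pi (fox j (f_ i)).
Proof. by rewrite /jacobian (magnus_invE p_pr F_free). Qed.

Lemma jacobian_map_linear : linear (J : _ -> {ffun 'I_d -> A}).
Proof.
move=> k g h; apply/ffunP => j; rewrite !ffunE scaler_sumr -big_split /=.
by apply: eq_bigr => i _; rewrite !ffunE mulrDl scalerAl.
Qed.

(** Fox's identity: for each [i] the sum over [j] of the derivatives of [f_i] times [x_j] is [f_i]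
    itself, which maps to zero. *)
Lemma jacobian_map_fox (g : {ffun 'I_r -> A}) :
  \sum_j J g j * Pi (ncpsX K j) = 0.
Proof.
under eq_bigr do rewrite ffunE mulr_suml.
rewrite exchange_big big1 //= => i _.
under eq_bigr do rewrite -mulrA jacobianE -rmorphM.
rewrite -mulr_sumr -rmorph_sum -(fox_decomp (rel_series_head i)) /=.
by rewrite presentation_map_rel // mulr0.
Qed.

(** Lifting [y] to series turns the hypothesis into membership in the kernel of [Pi] up to order
    [n]; the description of that kernel supplies the preimage [g]. *)
Lemma jacobian_map_exact n (y : {ffun 'I_d -> A}) :
  Ip n (\sum_j y j * Pi (ncpsX K j)) ->
  exists g, forall j, Ip (n - 1) ((y - J g) j).
Proof.
have /choice[al alE] : forall j, exists f, Pi f = y j.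
  by move=> j; exact: presentation_map_surj.
case/IpP => y0 y0n y0E; pose s := \sum_j al j * ncpsX K j.
have : Pi (s - y0) = 0.
  rewrite rmorphB /= y0E rmorph_sum; apply/eqP; rewrite subr_eq0; apply/eqP.
  by apply: eq_bigr => j _; rewrite rmorphM /= alE.
case/(ker_presentation_map phi_surj phi_rho rho_gen n) => b [k [k0]].
set z := (X in ncps_order_ge n X) => zn.
exists [ffun i => Pi (b i)] => j; apply/IpP; exists (fox j (z + y0)).
  by apply: ncps_order_ge_fox1; exact: ncps_order_geD.
have sE : s = z + y0 + (\sum_i b i * f_ i + \sum_j k j * ncpsX K j).
  by rewrite /z addrAC subrK subrK.
(* Taking the derivative [fox j] lowers the order of the error by one, turns [f_i] into its Jacobian
   entry, and isolates [k j], which [Pi] kills. *)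
have alj : al j = fox j (z + y0) + (\sum_i b i * fox j (f_ i) + k j).
  rewrite -(fox_sum al j) -/s sE !foxD; congr (_ + (_ + _)); last exact: fox_sum.
  rewrite fox_bigsum; apply: eq_bigr => i _.
  by rewrite fox_mul // rel_series_head.
rewrite !ffunE -alE alj !rmorphD /= k0 addr0 rmorph_sum /=.
rewrite [X in _ = _ + X - _](_ : _ =
  \sum_i [ffun i => Pi (b i)] i * jacobian p sigma phi rho i j) ?addrK//.
by apply: eq_bigr => i _; rewrite rmorphM ffunE jacobianE.
Qed.

(** Three filtrations are compared: [M] in [Kr] in A^r, [N] in [S] in A^d, and I^n in I in A. The
    Jacobian map identifies A^r/[Kr] with [S]/[N], and [L] identifies A^d/[S] with I/I^n. *)
Lemma jacobian_dim_formula n : (0 < n)%N ->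
  (\sum_i c (n - v i) + c n = jacobian_ker_dim p sigma phi rho v n + d * c (n - 1) + 1)%N.
Proof.
move=> n0.
pose M := [set g : {ffun 'I_r -> A} | forall i, Ip (n - v i) (g i)].
pose N := [set a : {ffun 'I_d -> A} | forall j, Ip (n - 1) (a j)].
pose Kr := [set g : {ffun 'I_r -> A} | N (J g)].
pose L (a : {ffun 'I_d -> A}) : A := \sum_j a j * Pi (ncpsX K j).
pose S := [set a : {ffun 'I_d -> A} | Ip n (L a)].
have sI m : subspace (Ip m) by exact: (aug_pow_subspace p_pr F_free phi_surj).
have dI m : quot_dim_is setT (Ip m) (c m) by exact: (aug_quot_dimP p_pr F_free phi_surj).
have sffun m (B : 'I_m -> set A) : (forall i, subspace (B i)) ->
    subspace [set a : {ffun 'I_m -> A} | forall i, B i (a i)].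
  move=> sB; split=> [i|k x y Bx By i]; rewrite !ffunE; first exact: (sB i).1.
  by apply: (sB i).2; [exact: Bx | exact: By].
have sM : subspace M by exact: (sffun r (fun i => Ip (n - v i)) (fun i => sI _)).
have sN : subspace N by exact: (sffun d (fun=> Ip (n - 1)) (fun=> sI _)).
have linL : linear L.
  move=> k x y; rewrite /L scaler_sumr -big_split /=; apply: eq_bigr => j _.
  by rewrite !ffunE mulrDl scalerAl.
have sKr : subspace Kr.
  split; last by move=> k x y Kx Ky; rewrite /Kr /= jacobian_map_linear; exact: sN.2.
  move=> j; rewrite ffunE big1 => [|i _]; first exact: (sI _).1.
  by rewrite ffunE mul0r.
have sS : subspace S.
  split; last by move=> k x y Sx Sy; rewrite /S /= linL; exact: (sI n).2.
  by rewrite /S /= /L big1 => [|j _]; [exact: (sI n).1 | rewrite ffunE mul0r].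
have Xp j : Ip 1 (Pi (ncpsX K j)).
  by apply/IpP; exists (ncpsX K j) => //; exact: ncpsX_order_ge.
have MK : M `<=` Kr.
  move=> g Mg j; rewrite ffunE; apply: subspace_sum => // i _.
  (* With truncated subtraction one still has [n - 1 <= (n - v i) + (v i - 1)]. *)
  apply: (@aug_pow_le _ _ _ _ _ _ p_pr F_free phi_surj _ (n - v i + (v i - 1))).
    have := rel_level_gt0 i; case: (v i) => // w _.
    by rewrite subSS subn0 leq_subLR addnCA add1n addnC -leq_subLR.
  apply: (aug_powM p_pr F_free phi_surj) => //; rewrite jacobianE; apply/IpP.
  by exists (fox j (f_ i)) => //; apply: ncps_order_ge_fox1; exact: rel_series_order.
have NS : N `<=` S.
  move=> a Na; rewrite /S /= /L; apply: subspace_sum => // j _.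
  by rewrite -(subnK n0); exact: (aug_powM p_pr F_free phi_surj).
have dM : quot_dim_is setT M (\sum_i c (n - v i))%N 
  by apply: (quot_dim_is_ffun (B := fun i => Ip (n - v i))).
have dN : quot_dim_is setT N (d * c (n - 1))%N.
  rewrite -[d in (d * _)%N]card_ord -sum_nat_const.
  by apply: (quot_dim_is_ffun (B := fun=> Ip (n - 1))).
have [k [l [dK dKM ->]]] := quot_dim_is_sub sKr MK sM (@subsetT _ _) dM.
have [k' [l' [dS dSN eN]]] := quot_dim_is_sub sS NS sN (@subsetT _ _) dN.
have [k1 [l1 [dI1 dIn ->]]] := quot_dim_is_sub (sI 1%N)
  (aug_pow_le p_pr F_free phi_surj n0) (sI n) (@subsetT _ _) (dI n).
have k11 : k1 = 1%N by exact: quot_dim_is_unique (sI 1%N) dI1 (aug_quot_dim1 p_pr F_free phi_surj).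
(* Exactness at the middle term gives surjectivity onto [S] modulo [N]; injectivity is the
   definition of [Kr]. *)
have kl' : k = l'.
  apply: (quot_dim_is_unique sN _ dSN).
  apply: (quot_dim_is_iso jacobian_map_linear sN (@subspaceT _ _)) dK => //.
    by move=> g _; rewrite /S /= /L jacobian_map_fox; exact: (sI n).1.
  by move=> y /jacobian_map_exact[g gP]; exists g.
(* Surjectivity onto I modulo I^n comes from the Fox decomposition of a series without constant
   term. *)
have kl1 : k' = l1.
  apply: (quot_dim_is_unique (sI n) _ dIn).
  apply: (quot_dim_is_iso linL (sI n) (@subspaceT _ _)) dS => //.
    move=> a _; apply: subspace_sum => // j _.
    by rewrite -[1%N]add0n; exact: (aug_powM p_pr F_free phi_surj).
  move=> y /IpP[f f1 <-]; exists [ffun j => Pi (fox j f)] => //.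
  rewrite {1}(fox_decomp (f1 [::] isT)) rmorph_sum /L.
  under [X in _ - X]eq_bigr do rewrite ffunE -rmorphM.
  by rewrite subrr; exact: (sI n).1.
have -> : jacobian_ker_dim p sigma phi rho v n = l by exact: quot_dim_is_xget dKM.
rewrite eN k11 kl' kl1 (addnC l') -!addnA; congr addn.
by rewrite [RHS]addnCA [(1 + _)%N]addnC.
Qed.

End ExactSequence.

(** Exchanging the summations counts each relation once, at its own level. The convention r_0 = 1
    yields the term [c n], and relations of level above [n] contribute [c 0 = 0]. *)
Lemma sum_num_rels r (v : 'I_r -> nat) (c : nat -> nat) n :
  (forall i, (0 < v i)%N) -> c 0%N = 0%N ->
  (\sum_(0 <= i < n.+1) num_rels v i * c (n - i) = c n + \sum_i c (n - v i))%N.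
Proof.
move=> v0 c0; rewrite big_nat_recl // mul1n subn0; congr addn.
rewrite (eq_bigr (fun k => \sum_(i < r) (v i == k.+1) * c (n - k.+1)))%N => [|k _].
  rewrite exchange_big /=; apply: eq_bigr => i _.
  have [vn|nv] := leqP (v i) n; last first.
    rewrite (eqP (ltnW nv)) c0 big_nat_cond big1 // => k /andP[/andP[_ kn] _].
    by case: eqP => // vk; move: nv; rewrite vk ltnNge kn.
  (* The term of index 0 has been split off, so level [v i] sits at the index [(v i).-1]. *)
  rewrite (bigD1_seq (v i).-1) ?iota_uniq ?mem_index_iota//=; last by rewrite prednK.
  rewrite prednK // eqxx mul1n big1 ?addn0// => k kv.
  by case: eqP => // vk; case/negP: kv; rewrite vk.
by rewrite -big_distrl /= -sum1_card big_mkcond.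
Qed.

Theorem theorem4 (p d r : nat) (G F : profiniteGroupType)
    (sigma : 'I_d -> F) (phi : {chom F -> G})
    (rho : 'I_r -> F) (v : 'I_r -> nat)
    (p_prime : prime p)
    (G_pro_p : pro_p p G)
    (G_gen_rank : dim_H1_is 'F_p G d)
    (G_rel_rank : dim_H2_is 'F_p G r)
    (G_presentation : minimal_presentation p r sigma phi)
    (G_relations : adapted_relations p phi rho v) :
  forall n : nat, (1 <= n)%N ->
    (\sum_(0 <= i < n.+1) num_rels v i * aug_quot_dim p G (n - i))%N%:Z
      - (d * aug_quot_dim p G (n - 1))%N%:Z
    = 1 + (jacobian_ker_dim p sigma phi rho v n)%:Z.
Proof.
move=> n n0; have [F_free phi_surj _ _] := G_presentation.
have [phi_rho rho_gen rho_level _] := G_relations.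
have c0 := aug_quot_dim0 p_prime F_free phi_surj.
have v0 := rel_level_gt0 rho_level.
rewrite (sum_num_rels n v0 c0) addnC.
rewrite (jacobian_dim_formula p_prime F_free phi_surj phi_rho rho_gen rho_level n0).
by rewrite -addnA addnCA !PoszD addrC addKr addrC.
Qed.
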